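(* Let $K$ be a field of characteristic zero and let $A$ be a standard graded Artinian Gorenstein $K$-algebra. Then the following conditions are equivalent. (i) $A$ has the SLP. (ii) There exists a linear form $z$ of $A$ such that all the central simple modules of $(A,z)$ have the SLP.
   Context: A standard graded Artinian $K$-algebra is a commutative graded algebra $A=\bigoplus_{i=0}^c A_i$ ($A_c\neq(0)$) of the form $R/I$, with $R=K[x_1,\dots,x_n]$ a polynomial ring with its standard grading, $I$ a homogeneous ideal, and $\dim_K A<\infty$. A linear form of $A$ is an element of $A_1$. $A$ has the Strong Lefschetz Property (SLP) if there is $g\in A_1$ such that $\times g^{c-2i}:A_i\to A_{c-i}$ is bijective for all $i=0,1,\dots,\lfloor c/2\rfloor$. A finite graded $A$-module $V=\bigoplus_{i=a}^b V_i$ with $V_a\neq(0)$, $V_b\neq(0)$ has the SLP if there is a linear form $g\in A_1$ such that $\times g^{b-a-2i}:V_{a+i}\to V_{b-i}$ is bijective for all $i=0,1,\dots,\lfloor (b-a)/2\rfloor$. Central simple modules: let $z\in A_1$. The multiplication map $\times z:A\to A$ is a nilpotent $K$-linear endomorphism; let $f_1>f_2>\cdots>f_s$ be the distinct sizes of the blocks occurring in its Jordan canonical form, and put $f_{s+1}=0$. For $1\le i\le s$ the $i$-th central simple module of $(A,z)$ is the graded $A$-module $$U_i=\frac{(0:z^{f_i})+(z)}{(0:z^{f_{i+1}})+(z)},$$ where $(0:z^k)=\{a\in A: az^k=0\}$. (Equivalently, $U_1,\dots,U_s$ are the non-zero successive quotients of the chain $A=(0:z^{f_1})+(z)\supset(0:z^{f_1-1})+(z)\supset\cdots\supset(0:z)+(z)\supset(z)$.)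 *)

(* Defs.v *)
From HB Require Import structures.
From mathcomp Require Import all_boot all_order all_algebra all_field.
From mathcomp Require Import generic_quotient ring_quotient.
From mathcomp Require Import mpoly.

Set Implicit Arguments.
Unset Strict Implicit.
Unset Printing Implicit Defensive.

Import GRing.Theory.
Local Open Scope ring_scope.
Local Open Scope quotient_scope.

Definition bij_between (T U : Type) (X : T -> Prop) (Y : U -> Prop)
    (h : T -> U) : Prop :=
  [/\ forall x, X x -> Y (h x),
      forall x y, X x -> X y -> h x = h y -> x = y
    & forall y, Y y -> exists2 x, X x & h x = y].

Section Submodule.
Variables (R : nzRingType) (V : lmodType R) (M : submodClosed V).

Record submodule : predArgType :=
  Submodule { submodule_val :> V; _ : submodule_val \in M }.

HB.instance Definition _ := [isSub for submodule_val].
HB.instance Definition _ := [Choice of submodule by <:].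
HB.instance Definition _ := [SubChoice_isSubLmodule of submodule by <:].

End Submodule.

Section QuotientModule.
Variables (R : nzRingType) (V : lmodType R) (N : submodClosed V).

(* A submodClosed predicate does not carry a zmodClosed structure.            *)
Definition submod_pred : {pred V} := fun x => x \in N.

Fact submod_pred_closed : zmod_closed submod_pred.
Proof. exact: GRing.submod_closedB (submodClosedP N). Qed.
HB.instance Definition _ :=
  GRing.isZmodClosed.Build V submod_pred submod_pred_closed.

Definition quotmod : Type := Quotient.quot submod_pred.
HB.instance Definition _ := GRing.Zmodule.on quotmod.
HB.instance Definition _ := Quotient.on quotmod.

Lemma quotmod_eqE (x y : V) :
  (\pi_quotmod x == \pi_quotmod y) = (x - y \in N).
Proof. exact/esym/(Quotient.idealrBE submod_pred). Qed.

Definition quotmod_scale (a : R) (u : quotmod) : quotmod :=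
  \pi_quotmod (a *: repr u).

Lemma pi_quotmodZ (a : R) (x : V) :
  quotmod_scale a (\pi_quotmod x) = \pi_quotmod (a *: x).
Proof.
apply/eqP; rewrite /quotmod_scale quotmod_eqE -scalerBr.
by rewrite rpredZ // -quotmod_eqE reprK.
Qed.

Lemma pi_quotmodD : {morph \pi_quotmod : x y / x + y >-> x + y}.
Proof. by move=> x y; exact (Quotient.pi_add submod_pred x y). Qed.

Fact quotmod_scaleA a b u :
  quotmod_scale a (quotmod_scale b u) = quotmod_scale (a * b) u.
Proof. by elim/quotW: u => x; rewrite (pi_quotmodZ b) !pi_quotmodZ scalerA. Qed.

Fact quotmod_scale1 : left_id 1 quotmod_scale.
Proof. by elim/quotW=> x; rewrite pi_quotmodZ scale1r. Qed.

Fact quotmod_scaleDr : right_distributive quotmod_scale +%R.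
Proof.
move=> a; elim/quotW=> x; elim/quotW=> y.
by rewrite -pi_quotmodD !pi_quotmodZ -pi_quotmodD scalerDr.
Qed.

Fact quotmod_scaleDl u : {morph quotmod_scale^~ u : a b / a + b}.
Proof.
by elim/quotW: u => x a b; rewrite !pi_quotmodZ -pi_quotmodD scalerDl.
Qed.

HB.instance Definition _ := GRing.Zmodule_isLmodule.Build R quotmod
  quotmod_scaleA quotmod_scale1 quotmod_scaleDr quotmod_scaleDl.

End QuotientModule.

(* M / N when N is contained in M; M / (M :&: N) in general.                  *)
Section Subquotient.
Variables (R : nzRingType) (V : lmodType R) (M N : submodClosed V).

Definition submodule_in : {pred submodule M} := [pred x | val x \in N].

Fact submodule_in_closed : submod_closed submodule_in.
Proof.
split=> [|a x y]; rewrite !inE /= ?rpred0 // => xN yN.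
by rewrite rpredD ?rpredZ.
Qed.
HB.instance Definition _ :=
  GRing.isSubmodClosed.Build R (submodule M) submodule_in submodule_in_closed.

Definition subquotient : lmodType R := quotmod submodule_in.

Definition pi_subquotient (x : submodule M) : subquotient :=
  \pi_(quotmod submodule_in) x.

Lemma pi_subquotientZ a x :
  pi_subquotient (a *: x) = a *: pi_subquotient x.
Proof. exact/esym/(pi_quotmodZ submodule_in). Qed.

Lemma pi_subquotientD : {morph pi_subquotient : x y / x + y >-> x + y}.
Proof. exact: (@pi_quotmodD _ _ submodule_in). Qed.

Lemma pi_subquotient_surj u : exists x, u = pi_subquotient x.
Proof.
by exists (repr (u : quotmod submodule_in)); rewrite /pi_subquotient reprK.
Qed.

Lemma pi_subquotient_eqE x y :
  (pi_subquotient x == pi_subquotient y) = (val x - val y \in N).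
Proof. exact: (quotmod_eqE submodule_in). Qed.

End Subquotient.

Section GradedAlgebra.
Variables (K : fieldType) (A : falgType K).
Implicit Types (gr : nat -> {vspace A}) (c : nat).

(* A is the graded algebra gr 0 (+) ... (+) gr c, and it is a quotient R / I  *)
(* of R = K[X_0, ..., X_(n-1)] by I = ker phi, with the grading induced by    *)
(* the standard grading of R; since the sum of the gr i is direct, the ideal  *)
(* I is homogeneous. Commutativity of A follows from surjectivity of phi, and *)
(* finite dimensionality is part of falgType.                                 *)
Definition standard_graded_artinian gr c : Prop :=
  [/\ directv (\sum_(i < c.+1) gr i)%VS,
      (\sum_(i < c.+1) gr i)%VS = fullv,
      gr c != 0%VS,
      forall i, (c < i)%N -> gr i = 0%VS
    & exists n (phi : {lrmorphism {mpoly K[n]} -> A}),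
        (forall a, exists p, phi p = a) /\
        (forall d a, a \in gr d <-> exists2 p, p \is d.-homog & phi p = a)].

(* The socle (0 : m), where m is the sum of the gr i with 0 < i.              *)
Definition in_socle gr (a : A) : Prop :=
  forall i x, (0 < i)%N -> x \in gr i -> x * a = 0.

(* An Artinian local ring is Gorenstein iff its socle has length one.         *)
Definition gorenstein gr : Prop :=
  exists S : {vspace A},
    \dim S = 1%N /\ (forall a, a \in S <-> in_socle gr a).

Definition algebra_SLP gr c : Prop :=
  exists2 g, g \in gr 1%N &
    forall i, (i <= c./2)%N ->
      bij_between (fun x => x \in gr i) (fun x => x \in gr (c - i)%N)
        (fun x => g ^+ (c - i.*2) * x).

Definition module_SLP gr (V : lmodType A) (piece : nat -> V -> Prop) : Prop :=
  exists a b,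
    [/\ exists2 v, piece a v & v != 0,
        exists2 v, piece b v & v != 0,
        forall j v, piece j v -> v != 0 -> (a <= j <= b)%N
      & exists2 g, g \in gr 1%N &
          forall i, (i <= (b - a)./2)%N ->
            bij_between (piece (a + i)%N) (piece (b - i)%N)
              (fun v => g ^+ (b - a - i.*2) *: v)].

(* The nilpotent Jordan block of size m.                                      *)
Definition jordan_block m : 'M[K]_m := \matrix_(i, j) (j == i.+1 :> nat)%:R.

(* h has, in some basis, the block diagonal matrix with nilpotent Jordan      *)
(* blocks of (nonzero) sizes p 0, ..., p (r-1) on the diagonal.               *)
Definition jordan_form (h : 'End(A)) r (p : 'I_r -> nat) : Prop :=
  (forall k, 0 < p k)%N /\
  exists e : (\sum_k p k).-tuple A,
    basis_of fullv e /\
    forall j, h (tnth e j) =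
      \sum_i (\mxdiag_k jordan_block (p k)) i j *: tnth e i.

Definition jordan_sizes (h : 'End(A)) (f : seq nat) : Prop :=
  sorted gtn f /\
  exists r (p : 'I_r -> nat), jordan_form h p /\ f =i codom p.

(* (0 : z^k) + (z), as a submodule of A. *)
Definition ann_add (z : A) (k : nat) : {pred A^o} :=
  fun a => a \in (lker (amulr (z ^+ k)%R) + limg (amulr z))%VS.

Fact ann_add_closed z k : submod_closed (ann_add z k).
Proof.
split=> [|a x y]; first exact: mem0v.
move=> xM yM; apply: memvD yM; case/memv_addP: xM => u.
rewrite memv_ker lfunE /= => /eqP u0.
case=> _ /memv_imgP[v _ ->] ->; rewrite /GRing.scale /= mulrDr memv_add //.
  by rewrite memv_ker lfunE /= -mulrA u0 mulr0.
have -> : a * amulr z v = amulr z (a * v) by rewrite !lfunE /= mulrA.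
by rewrite memv_img ?memvf.
Qed.
HB.instance Definition _ z k :=
  GRing.isSubmodClosed.Build A A^o (ann_add z k) (ann_add_closed z k).

(* U_i, with i counted from 0; nth returns 0 past the last block size.        *)
Definition central_simple_module z (f : seq nat) i : lmodType A :=
  subquotient (ann_add z (nth 0%N f i)) (ann_add z (nth 0%N f i.+1)).

Definition central_simple_piece gr z (f : seq nat) i (j : nat)
    (u : central_simple_module z f i) : Prop :=
  exists x : submodule (ann_add z (nth 0%N f i)),
    (val x : A) \in gr j /\ u = pi_subquotient _ x.

Definition central_simple_modules_SLP gr z : Prop :=
  exists f, jordan_sizes (amulr z) f /\
    forall i, (i < size f)%N ->
      module_SLP gr (@central_simple_piece gr z f i).

End GradedAlgebra.

(* Main.v *)
Require Import Defs.
From mathcomp Require Import all_boot all_order all_algebra all_field.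
From mathcomp Require Import zify mpoly.
Set Implicit Arguments.
Unset Strict Implicit.
Unset Printing Implicit Defensive.
Import GRing.Theory.
Local Open Scope ring_scope.

(** Write V_k = (0 : z^k) + (z). Both directions rest on the quotients
    V_(m+1) / V_m, which are the central simple modules when m+1 is the size
    of a Jordan block of z and vanish otherwise: in a Jordan basis, an element
    lies in V_m when it has no component on the tops of the blocks of size
    greater than m ([annv_chainP], [annv_next_size]).

    Let phi be a nonzero functional that vanishes outside degree c. Since A is
    Gorenstein, phi(ab) is a perfect pairing on A, and (z^m A)^perp = (0 : z^m)
    makes phi(z^m x y), for x and y in (0 : z^(m+1)), a perfect pairing on
    V_(m+1) / V_m. So the nonzero degrees of this quotient are symmetric under
    j -> c - m - j ([central_dual]), and the Lefschetz maps of a central simple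
    module with SLP are the powers g^n from degree j with n + 2j + m = c.

    (i) => (ii). Take for z a strong Lefschetz element of A. If
    2j < c - m, then z^(m+1) is injective on degree j, so V_(m+1) / V_m is
    zero in degree j; by symmetry it is concentrated in the one degree with
    2j = c - m ([SLP_central_support]), where SLP is trivial.

    (ii) => (i). For every k, multiplication by z^k identifies A / V_k with
    z^k A / z^(k+1) A, so the associated graded module of the filtration by
    powers of z is the sum of the (A / V_k) t^k. The chain of the V_m filters
    it by (V_(m+1) / V_m)[t] / t^(m+1). If g is a Lefschetz element of all the
    V_(m+1) / V_m, then g + t is one for each of these pieces. This is the
    Clebsch-Gordan theorem; here it is proved by differentiating with respect
    to t, with no decomposition into strings ([string_injective]). By the
    symmetry above all pieces have the same centre c/2, so g + t is a
    Lefschetz element of the associated graded module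
    ([filtered_string_injective]). The pencil z + s g degenerates to g + t, and
    a kernel vector that is polynomial in s would have a nonzero leading
    symbol in the kernel of a power of g + t ([pencil_inj]). So a determinant
    is a nonzero polynomial in s, and z + s g is a strong Lefschetz element
    for all but finitely many s. That one g serves all the central simple
    modules follows from the openness of the Lefschetz condition along lines
    ([line_open_common]). *)

(** * Powers of g + t on a module tensored with K[t]/t^f *)
Section StringInjectivity.
Variables (K : fieldType) (charK : [pchar K] =i pred0) (A : falgType K).
Variables (gr : nat -> {vspace A}) (g : A).
Hypothesis gM : forall i x, x \in gr i -> g * x \in gr i.+1.
Implicit Types (U V : {vspace A}) (p : {poly A}).

Lemma natr_memv V n (x : A) : (0 < n)%N -> x *+ n \in V -> x \in V.
Proof.
move=> n0; rewrite -scaler_nat => /(memvZ (n%:R^-1)).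
by rewrite scalerA mulVf ?scale1r // (pcharf0P _).1 // -lt0n.
Qed.

Lemma mulrn_memv V n (x : A) : x \in V -> x *+ n \in V.
Proof. by rewrite -scaler_nat; apply: memvZ. Qed.

(** Homogeneity of total degree e at t^k, where t = 'X has degree 1; the test
    on k avoids that truncated subtraction puts t^k in degree 0 for k > e. *)
Definition bihomog e p k : Prop :=
  p`_k \in (if (k <= e)%N then gr (e - k) else 0%VS).

Lemma derivXaddC_exp d p :
  (((g%:P + 'X) ^+ d.+1 * p)^`()
     = (g%:P + 'X) ^+ d * (p *+ d.+1 + (g%:P + 'X) * p^`())).
Proof.
elim: d p => [|d IH] p.
  by rewrite expr0 expr1 mul1r derivM derivD derivC derivX add0r mul1r mulr1n.
rewrite exprSr -mulrA IH derivM derivD derivC derivX add0r mul1r.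
rewrite [in RHS]exprSr -mulrA; congr (_ * _).
by rewrite (mulrSr p d.+1) !mulrDr mulrnAr addrA.
Qed.

Lemma coef_CaddX_mul p k :
  ((g%:P + 'X) * p)`_k = g * p`_k + (if k is k'.+1 then p`_k' else 0).
Proof. by rewrite mulrDl coefD coefCM coefXM; case: k. Qed.

(** With L = g + t, the power L^d is injective in degree e on (U/V)[t]/t^f,
    provided that the powers of g are injective on U/V below the centre s/2.
    Induction on f: if L^(d+1) p = 0 modulo t^f, its derivative
    L^d ((d+1) p + L p') vanishes modulo t^(f-1), so by induction
    (d+1) p + L p' = 0 modulo t^(f-1), that is
    (d+1+k) p_k = -(k+1) g p_(k+1) in U/V. This determines p from its last
    coefficient p_(f-1), and the constant term g^(d+1) p_0 = 0 of the equation
    becomes g^(d+f) p_(f-1) = 0, where the hypothesis applies. *)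
Lemma string_injective U V s :
  (forall x, x \in U -> g * x \in U) -> (forall x, x \in V -> g * x \in V) ->
  (forall n i x, (n + i.*2)%N = s ->
     x \in U -> x \in gr i -> g ^+ n * x \in V -> x \in V) ->
  forall f d e p, (d + e.*2).+1 = (s + f)%N ->
  (forall k, (k < f)%N -> p`_k \in U /\ bihomog e p k) ->
  (forall k, (k < f)%N -> ((g%:P + 'X) ^+ d * p)`_k \in V) ->
  forall k, (k < f)%N -> p`_k \in V.
Proof.
move=> gU gV injs; elim=> [//|f IH] [|d] e p def_s pU LpV k kf.
  by have := LpV k kf; rewrite expr0 mul1r.
(* q is the cofactor of L^d in the derivative of L^(d+1) p. *)
pose q := p *+ d.+1 + (g%:P + 'X) * p^`().
have qE j : q`_j = p`_j *+ (d.+1 + j) + g * p`_j.+1 *+ j.+1.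
  rewrite coefD coefMn coef_CaddX_mul coef_deriv mulrnAr mulrnDr.
  rewrite [in RHS]addrAC -addrA; congr (_ + (_ + _)).
  by case: j => [|j]; rewrite ?coef_deriv // mulr0n.
have qV j : (j < f)%N -> q`_j \in V.
  apply: (IH d e) => [|i lif|i lif]; first lia.
  - have [[pU0 ph0] [pU1 ph1]] := (pU i (ltnW lif), pU i.+1 lif).
    rewrite /bihomog qE; split; first by rewrite memvD ?mulrn_memv ?gU.
    apply/memvD/mulrn_memv; first exact: mulrn_memv.
    move: ph1; rewrite /bihomog; case: (leqP i.+1 e) => [lie|_].
      by move/gM; rewrite subnSK ?(ltnW lie).
    by rewrite memv0 => /eqP->; rewrite mulr0 mem0v.
  - have := LpV i.+1 lif; move/(mulrn_memv i.+1).
    by rewrite -coef_deriv derivXaddC_exp.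
(* The recursion carries the constant term up to the last coefficient, *)
have gpV j : (j < f.+1)%N -> g ^+ (d.+1 + j) * p`_j \in V.
  elim: j => [|j IHj] jf.
    suff coefL0 r : ((g%:P + 'X) ^+ r * p)`_0 = g ^+ r * p`_0.
      by rewrite addn0 -coefL0 LpV.
    elim: r p {LpV pU q qE qV} => [|r IHr] p; first by rewrite !mul1r.
    by rewrite exprS -mulrA coef_CaddX_mul addr0 IHr mulrA -exprS.
  have := qV j jf; rewrite qE => qj.
  have gnV n x : x \in V -> g ^+ n * x \in V.
    by move=> xV; elim: n => [|n IHn]; rewrite ?mul1r // exprS -mulrA gV.
  have := gnV (d.+1 + j)%N _ qj; rewrite mulrDr !mulrnAr mulrA -exprSr.
  rewrite rpredDl; last by rewrite mulrn_memv ?IHj // ltnW.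
  by rewrite addnS; apply: natr_memv.
have fV : p`_f \in V.
  have [pU0] := pU f (leqnn _); rewrite /bihomog.
  case: leqP => [lfe pgr|_]; last by rewrite memv0 => /eqP->; rewrite mem0v.
  apply: (injs (d.+1 + f)%N (e - f)%N) => //; [lia | exact: gpV].
(* and then carries the vanishing of the last coefficient back down. *)
have down i : (i <= f)%N -> p`_(f - i) \in V.
  elim: i => [|i IHi] lif; first by rewrite subn0.
  have jf : (f - i.+1 < f)%N by lia.
  have := qV _ jf; rewrite qE -subSn // subSS rpredDr.
    exact: natr_memv.
  by apply/mulrn_memv/gV/IHi/ltnW.
by rewrite -(subKn (kf : (k <= f)%N)) down ?leq_subr.
Qed.

(** L^d is injective on the sum of the (A / V_k) t^k in degree e = (c - d)/2:
    assuming that the p_k lie in V_max(k,m+1), the previous lemma for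
    V_(m+1) / V_m and f = m+1 puts them in V_max(k,m). *)
Lemma filtered_string_injective (V : nat -> {vspace A}) c :
  (forall m x, x \in V m -> g * x \in V m) ->
  (forall m, (V m <= V m.+1)%VS) -> V c.+1 = fullv ->
  (forall m n i x, (n + i.*2 + m)%N = c ->
     x \in V m.+1 -> x \in gr i -> g ^+ n * x \in V m -> x \in V m) ->
  forall d e p, (d + e.*2)%N = c -> (forall k, bihomog e p k) ->
  (forall k, (k <= c)%N -> ((g%:P + 'X) ^+ d * p)`_k \in V k) ->
  forall k, (k <= c)%N -> p`_k \in V k.
Proof.
move=> gV Vmono Vfull injV d e p def_c hp LpV.
have VS i j : (i <= j)%N -> (V i <= V j)%VS.
  by move/subnK<-; elim: (j - i)%N => // n; move/subv_trans; apply.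
(* Induction on j = c + 1 - m. *)
suff pV j : (j <= c.+1)%N -> forall k, (k <= c)%N -> p`_k \in V (maxn k (c.+1 - j)).
  by move=> k kc; have := pV c.+1 (leqnn _) k kc; rewrite subnn maxn0.
elim: j => [|j IHj] jc k kc; first by rewrite subn0 (maxn_idPr (leqW kc)) Vfull memvf.
have {}IHj := IHj (ltnW jc); rewrite subSS; set m := (c - j)%N.
have [mk|km] := ltnP m k.
  by have := IHj k kc; rewrite subSn // (maxn_idPl _).
apply: (@string_injective (V m.+1) (V m) (c - m)%N _ _ _ m.+1 d e p) => //.
- exact: gV.
- exact: gV.
- by move=> n i x def_n; apply: injV; lia.
- by lia.
- move=> i im; split=> //; have := IHj i.
  by rewrite subSn // -/m (maxn_idPr _) ?(ltnW im) //; apply; lia.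
- by move=> i im; apply: (subvP (VS i m im)); apply: LpV; lia.
Qed.

End StringInjectivity.

(** * Homogeneous components and Gorenstein duality *)
Section GradedAlgebraFacts.
Variables (K : fieldType) (A : falgType K) (gr : nat -> {vspace A}) (c : nat).
Hypothesis stdA : standard_graded_artinian gr c.

Lemma std_mulC (x y : A) : x * y = y * x.
Proof.
case: stdA => _ _ _ _ [n [phi [surj _]]].
by have [[p <-] [q <-]] := (surj x, surj y); rewrite -!rmorphM mulrC.
Qed.

Lemma grM i j x y : x \in gr i -> y \in gr j -> x * y \in gr (i + j)%N.
Proof.
case: stdA => _ _ _ _ [n [phi [_ phiP]]].
move=> /phiP[p ph <-] /phiP[q qh <-]; rewrite -rmorphM.
by apply/phiP; exists (p * q); rewrite ?dhomogM.
Qed.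

Lemma gr1 : 1 \in gr 0.
Proof.
case: stdA => _ _ _ _ [n [phi [_ phiP]]].
by apply/phiP; exists 1; rewrite ?dhomog1 ?rmorph1.
Qed.

Lemma grX i n x : x \in gr i -> x ^+ n \in gr (i * n)%N.
Proof.
move=> xi; elim: n => [|n IH]; first by rewrite muln0 gr1.
by rewrite exprS mulnS grM.
Qed.

Lemma gr_gt i : (c < i)%N -> gr i = 0%VS.
Proof. by case: stdA => _ _ _ + _; apply. Qed.

Lemma gr1_expr_eq0 z : z \in gr 1 -> z ^+ c.+1 = 0.
Proof.
by move=> /(grX c.+1); rewrite mul1n gr_gt ?leqnn // memv0 => /eqP.
Qed.

Fact gr_sum_fullv : fullv = (\sum_(0 <= i < c.+1) gr i)%VS.
Proof. by case: stdA => _ <- _ _ _; rewrite big_mkord. Qed.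

Definition hcomp (i : nat) : 'End(A) :=
  if (i <= c)%N then sumv_pi_for gr_sum_fullv i else 0.

Lemma hcomp_mem i x : hcomp i x \in gr i.
Proof.
rewrite /hcomp; case: ifP => _; last by rewrite lfunE mem0v.
exact: memv_sum_pi.
Qed.

Lemma hcomp_sum x : x = \sum_(i < c.+1) hcomp i x.
Proof.
rewrite -[LHS](sumv_pi_nat_sum gr_sum_fullv (memvf x)) big_mkord.
by apply: eq_bigr => i _; rewrite /hcomp -ltnS ltn_ord.
Qed.

Lemma hcomp_homog i j x : x \in gr j -> hcomp i x = if i == j then x else 0.
Proof.
move=> xj.
have [cj|jc] := ltnP c j.
  move: xj; rewrite gr_gt // memv0 => /eqP->; rewrite linear0.
  by rewrite if_same.
have [ci|ic] := ltnP c i.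
  rewrite /hcomp leqNgt ci lfunE; case: eqP => // def_i.
  by move: xj ci; rewrite ltnNge def_i jc.
case: stdA => dir _ _ _ _.
have /directv_sum_unique uniq := dir.
have delta k : (if k == j then x else 0) \in gr k.
  by case: eqP => [->|]; rewrite ?mem0v.
have /esym := uniq (fun k : 'I_c.+1 => hcomp k x)
  (fun k : 'I_c.+1 => if (k : nat) == j then x else 0)
  (fun k _ => hcomp_mem k x) (fun k _ => delta k).
rewrite -hcomp_sum -big_mkcond /= (big_pred1 (Ordinal (jc : (j < c.+1)%N))) // eqxx.
by move=> /forallP/(_ (Ordinal (ic : (i < c.+1)%N)))/eqP.
Qed.


(** Cases are needed because degrees are natural numbers: for i < d the
    component of z x in degree i is zero. *)
Lemma hcompM d z i x : z \in gr d ->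
  hcomp i (z * x) = if (d <= i)%N then z * hcomp (i - d) x else 0.
Proof.
move=> zd; rewrite {1}(hcomp_sum x) mulr_sumr linear_sum /=.
under eq_bigr => k _ do rewrite (hcomp_homog _ (grM zd (hcomp_mem k x))).
rewrite -big_mkcond /=; case: leqP => [di|ltid]; last first.
  by rewrite big_pred0 // => k; apply/negbTE; lia.
have [ic|ci] := leqP (i - d) c.
  rewrite (big_pred1 (Ordinal (ic : (i - d < c.+1)%N))) // => k.
  by apply/eqP/eqP => [def_i|->]; [apply: val_inj => /=; lia | rewrite /= subnKC].
rewrite big_pred0 => [|k]; first by rewrite /hcomp leqNgt ci lfunE mulr0.
by have := ltn_ord k; lia.
Qed.


Definition annv (z : A) (k : nat) : {vspace A} :=
  (lker (amulr (z ^+ k)%R) + limg (amulr z))%VS.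

Lemma annvP z k x :
  x \in annv z k <-> exists u w, z ^+ k * u = 0 /\ x = u + z * w.
Proof.
split=> [/memv_addP[u]|[u [w [zu ->]]]].
  rewrite memv_ker lfunE /= std_mulC => /eqP zu [_ /memv_imgP[w _ ->] ->].
  by exists u, w; rewrite lfunE /= (std_mulC w).
apply: memv_add; first by rewrite memv_ker lfunE /= std_mulC zu.
by apply/memv_imgP; exists w; rewrite ?memvf // lfunE /= std_mulC.
Qed.

Lemma annvM z k a x : x \in annv z k -> a * x \in annv z k.
Proof.
move=> /annvP[u [w [zu ->]]]; apply/annvP; exists (a * u), (a * w).
rewrite mulrA (std_mulC _ a) -mulrA zu mulr0; split=> //.
by rewrite mulrDr !mulrA (std_mulC a z).
Qed.

Lemma annvS z k : (annv z k <= annv z k.+1)%VS.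
Proof.
apply/subvP=> x /annvP[u [w [zu ->]]]; apply/annvP; exists u, w; split=> //.
by rewrite exprS -mulrA zu mulr0.
Qed.

Lemma annv_full z : z \in gr 1 -> annv z c.+1 = fullv.
Proof.
move=> z1; apply/vspaceP => x; rewrite memvf; apply/annvP; exists x, 0.
by rewrite gr1_expr_eq0 // mul0r mulr0 addr0.
Qed.

Hypothesis gorA : gorenstein gr.

(** The top degree always lies in the socle, and the socle is a line. *)
Lemma in_socleP a : in_socle gr a <-> a \in gr c.
Proof.
have grc_soc b : b \in gr c -> in_socle gr b.
  move=> bc i x i0 /grM/(_ bc); rewrite gr_gt; last lia.
  by rewrite memv0 => /eqP.
split=> [|/grc_soc//]; case: gorA => S [dimS SP] /SP.
suff <- : gr c = S by [].
apply/eqP; rewrite eqEdim; apply/andP; split.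
  by apply/subvP=> b /grc_soc/SP.
by case: stdA => _ _ + _ _; rewrite dimS lt0n dimv_eq0.
Qed.

(** Perfectness of the pairing of degrees j and c - j into degree c: below
    degree c a nonzero x is not in the socle, so it can be multiplied into a
    higher degree without vanishing. *)
Lemma gr_pairing j x : x \in gr j ->
  (forall y, y \in gr (c - j) -> x * y = 0) -> x = 0.
Proof.
have [n] := ubnP (c - j); elim: n j x => // n IH j x ltn xj xy0.
have [cj|jc] := ltnP c j; first by apply/eqP; rewrite -memv0 -(gr_gt cj).
have [def_j|j_neq_c] := eqVneq j c.
  by rewrite -[x]mulr1 xy0 // def_j subnn gr1.
have xc : x \in gr c.
  apply/in_socleP => i y i0 yi; have [cij|ijc] := ltnP c (i + j).
    by apply/eqP; rewrite -memv0 -(gr_gt cij) grM.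
  apply: (IH (i + j)%N); [lia | exact: grM |] => y' y'c.
  rewrite (std_mulC y) -mulrA xy0 //.
  have -> : (c - j = i + (c - (i + j)))%N by lia.
  exact: grM.
have := hcomp_homog j xc.
by rewrite (hcomp_homog j xj) eqxx (negPf j_neq_c) => ->.
Qed.

Lemma exists_orientation : exists phi : {scalar A},
  (forall i x, x \in gr i -> i != c -> phi x = 0)
  /\ (forall x, x \in gr c -> phi x = 0 -> x = 0).
Proof.
have [v0 defc] : exists v, gr c = <[v]>%VS /\ v != 0.
  exists (vpick (gr c)); split; last by rewrite vpick0; case: stdA.
  case: gorA => S [dimS SP]; apply/esym/eqP; rewrite eqEdim.
  rewrite -memvE memv_pick dim_vline vpick0.
  have -> : gr c != 0%VS by case: stdA.
  suff -> : gr c = S by rewrite dimS.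
  by apply/vspaceP => a; apply/idP/idP => [/in_socleP/SP | /SP/in_socleP].
case: defc => defc v_neq0.
have freev : free [tuple v0] by rewrite seq1_free.
exists (coord [tuple v0] ord0 \o hcomp c); split=> [i x xi|x xc] /=.
  by rewrite eq_sym (hcomp_homog c xi) => /negPf->; rewrite linear0.
rewrite (hcomp_homog c xc) [c == c]eqxx; move: xc; rewrite defc => /vlineP[k ->].
have := coord_free ord0 ord0 freev; rewrite /= => coord1.
by rewrite linearZ /= coord1 mulr1 => ->; rewrite scale0r.
Qed.


Section Orientation.
Variable phi : {scalar A}.
Hypothesis phi_gr : forall i x, x \in gr i -> i != c -> phi x = 0.
Hypothesis phi_top : forall x, x \in gr c -> phi x = 0 -> x = 0.

Lemma phi_hcomp x : phi x = phi (hcomp c x).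
Proof.
rewrite {1}(hcomp_sum x) linear_sum (bigD1 ord_max) //= big1 ?addr0 // => i.
rewrite -val_eqE /=; apply: phi_gr; exact: hcomp_mem.
Qed.

Lemma phi_nondeg x : (forall y, phi (x * y) = 0) -> x = 0.
Proof.
move=> xy0; rewrite (hcomp_sum x) big1 // => i _.
apply: gr_pairing (hcomp_mem i x) _ => y yi; apply: phi_top.
  by have := grM (hcomp_mem i x) yi; rewrite subnKC // -ltnS.
have := xy0 y; rewrite phi_hcomp (std_mulC x y) (hcompM _ _ yi) leq_subr.
by rewrite subKn -1?ltnS // (std_mulC y).
Qed.

(** A basis reduces the search for y to a finite one, which keeps the choice
    of y constructive. *)
Lemma phi_witness x : x != 0 -> exists y, phi (x * y) != 0.
Proof.
move=> x0; have [/existsP[i pi]|] :=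
    boolP [exists i : 'I_(\dim {:A}), phi (x * (vbasis {:A})`_i) != 0].
  by exists (vbasis {:A})`_i.
rewrite negb_exists => /forallP phi0; case/eqP: x0; apply: phi_nondeg => y.
rewrite (coord_vbasis (memvf y)) mulr_sumr linear_sum big1 // => i _.
by rewrite -scalerAr linearZ /= (eqP (negPn (phi0 i))) mulr0.
Qed.

(** The Gram matrix of the nondegenerate form phi(xy) is invertible. *)
Lemma phi_represents (l : {scalar A}) : exists y, forall x, l x = phi (x * y).
Proof.
pose X := vbasis {:A}; pose n := \dim {:A}.
pose G : 'M[K]_n := \matrix_(i, j) phi (X`_i * X`_j).
have Gunit : G \in unitmx.
  rewrite -row_free_unit; apply: inj_row_free => v vG.
  have x0 : \sum_i v 0 i *: X`_i = 0.
    apply: phi_nondeg => y; rewrite (coord_vbasis (memvf y)) mulr_sumr.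
    rewrite linear_sum big1 // => j _; rewrite -scalerAr linearZ /=.
    rewrite mulr_suml linear_sum /=.
    rewrite (_ : \sum_(i < n) _ = (v *m G) 0 j); first by rewrite vG mxE mulr0.
    rewrite [RHS]mxE; apply: eq_bigr => i _.
    by rewrite -scalerAl linearZ /= [G i j]mxE.
  have /freeP := basis_free (vbasisP {:A}).
  by move=> /(_ (v 0) x0) v0; apply/rowP => i; rewrite v0 mxE.
pose cf := invmx G *m \col_i l X`_i.
exists (\sum_j cf j 0 *: X`_j) => x.
rewrite (coord_vbasis (memvf x)) mulr_suml !linear_sum; apply: eq_bigr => i _.
rewrite -scalerAl !linearZ /=; congr (_ * _).
have /matrixP/(_ i 0) : G *m cf = \col_i l X`_i by rewrite mulKVmx.
rewrite !mxE => <-; rewrite mulr_sumr linear_sum; apply: eq_bigr => j _.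
by rewrite -scalerAr linearZ /= mxE mulrC.
Qed.

(** The double orthogonal of uA is uA: a functional that vanishes on uA but
    not at v has the form phi(- y), and nondegeneracy turns phi(uAy) = 0
    into uy = 0. *)
Lemma phi_separates u v : (forall w, v <> u * w) ->
  exists y, u * y = 0 /\ phi (v * y) != 0.
Proof.
move=> vu; pose W := limg (amull u).
have [y0 py0] : exists y, phi ((v - projv W v) * y) != 0.
  apply: phi_witness; rewrite subr_eq0; apply/eqP => def_v.
  have: v \in W by rewrite def_v memv_proj.
  by case/memv_imgP => w _; rewrite lfunE /=; apply: vu.
pose l : {scalar A} := phi \o (amulr y0 \o (\1 - projv W))%VF.
have lE x : l x = phi ((x - projv W x) * y0) by rewrite /= !lfunE /= !lfunE /= !lfunE.
have [y yE] := phi_represents l.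
exists y; split; last by rewrite -yE lE.
apply: phi_nondeg => a; rewrite -mulrA (std_mulC y) mulrA -yE lE.
rewrite projv_id ?subrr ?mul0r ?linear0 //.
by apply/memv_imgP; exists a; rewrite ?memvf // lfunE.
Qed.


(** Write x = u + z w with z^(m+1) u = 0. As x is not in V_m, z^m u is not in
    z^(m+1) A, so some y0 killed by z^(m+1) has phi(z^m u y0) <> 0, and the
    homogeneous component of y0 of the complementary degree is the required
    y: it is not in V_m, because z^m u annihilates both (0 : z^m) and (z). *)
Lemma phi_central_dual z j m x : z \in gr 1 -> x \in gr j ->
  x \in annv z m.+1 -> x \notin annv z m ->
  (j + m <= c)%N /\
  exists y, [/\ y \in gr (c - m - j), y \in annv z m.+1 & y \notin annv z m].
Proof.
move=> z1 xj /annvP[u [w [zu def_x]]] xnV.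
have zum : forall w', z ^+ m * u <> z ^+ m.+1 * w'.
  move=> w' zuw; case/negP: xnV; apply/annvP; exists (u - z * w'), (w' + w).
  by rewrite mulrBr zuw mulrA -exprSr subrr mulrDr addrA subrK.
have [y0 [zy0 py0]] := phi_separates zum.
(* On (0 : z^(m+1)), u can be replaced by the homogeneous element x. *)
have zumE y : z ^+ m.+1 * y = 0 -> z ^+ m * u * y = z ^+ m * x * y.
  move=> zy; rewrite def_x mulrDr mulrDl mulrA -exprSr.
  by rewrite -(mulrA _ w) (std_mulC w) mulrA zy mul0r addr0.
have zmx : z ^+ m * x \in gr (m + j).
  by have := grM (grX m z1) xj; rewrite mul1n.
have {py0} := py0; rewrite zumE // phi_hcomp (hcompM _ _ zmx).
case: leqP => [jmc py|_]; last by rewrite linear0 eqxx.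
split; first by rewrite addnC.
pose y := hcomp (c - m - j) y0; have def_y : hcomp (c - (m + j)) y0 = y by rewrite subnDA.
have zy : z ^+ m.+1 * y = 0.
  have := congr1 (hcomp (m.+1 + (c - m - j))) zy0.
  rewrite (hcompM _ _ (grX m.+1 z1)) linear0 mul1n leq_addr.
  by rewrite addKn.
exists y; split; first exact: hcomp_mem.
  by apply/annvP; exists y, 0; rewrite mulr0 addr0.
apply/negP => /annvP[u' [w' [zu' yE]]].
move: py; rewrite def_y -zumE // yE mulrDr.
rewrite -(mulrA _ u u') (std_mulC u) mulrA zu' mul0r add0r.
rewrite -(mulrA _ u) (std_mulC u) !mulrA -exprSr -mulrA (std_mulC w') mulrA.
by rewrite zu mul0r linear0 eqxx.
Qed.

End Orientation.

Lemma central_dual z j m x : z \in gr 1 -> x \in gr j ->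
  x \in annv z m.+1 -> x \notin annv z m ->
  (j + m <= c)%N /\
  exists y, [/\ y \in gr (c - m - j), y \in annv z m.+1 & y \notin annv z m].
Proof. by have [phi [pg pt]] := exists_orientation; apply: phi_central_dual pg pt _ _ _ _. Qed.

(** The Gram matrix of the pairing between bases of the two degrees has
    independent rows. *)
Lemma dim_gr_le j : (j <= c)%N -> (\dim (gr j) <= \dim (gr (c - j)))%N.
Proof.
move=> jc; have [phi [pg pt]] := exists_orientation.
pose X := vbasis (gr j); pose Y := vbasis (gr (c - j)).
pose G : 'M[K]_(\dim (gr j), \dim (gr (c - j))) := \matrix_(i, k) phi (X`_i * Y`_k).
suff: row_free G by rewrite -row_leq_rank => /leq_trans; apply; apply: rank_leq_col.
apply: inj_row_free => v vG.
have x0 : \sum_i v 0 i *: X`_i = 0.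
  apply: (@gr_pairing j) => [|y yc].
    by apply: memv_suml => i _; rewrite memvZ // vbasis_mem // mem_nth ?size_tuple.
  apply: pt.
    rewrite -(subnKC jc) grM //.
    by apply: memv_suml => i _; rewrite memvZ // vbasis_mem // mem_nth ?size_tuple.
  rewrite (coord_vbasis yc) mulr_sumr.
  rewrite linear_sum big1 // => k _; rewrite -scalerAr linearZ /=.
  rewrite mulr_suml linear_sum /=.
  rewrite (_ : \sum_(i < _) _ = (v *m G) 0 k); first by rewrite vG mxE mulr0.
  rewrite [RHS]mxE; apply: eq_bigr => i _.
  by rewrite -scalerAl linearZ /= [G i k]mxE.
have /freeP := basis_free (vbasisP (gr j)).
by move=> /(_ (v 0) x0) v0; apply/rowP => i; rewrite v0 mxE.
Qed.

Lemma dim_gr_sym j : (j <= c)%N -> \dim (gr j) = \dim (gr (c - j)).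
Proof.
move=> jc; apply/eqP; rewrite eqn_leq dim_gr_le //=.
by have := dim_gr_le (leq_subr j c); rewrite subKn.
Qed.


End GradedAlgebraFacts.

(** * Degeneration of the pencil z + s g *)
Section Degeneration.
Variables (K : fieldType) (A : falgType K) (gr : nat -> {vspace A}) (c : nat).
Hypothesis stdA : standard_graded_artinian gr c.
Variables (z g : A).
Hypothesis z1 : z \in gr 1.
Implicit Types (p b : {poly A}).

Let L : {poly A} := g%:P + 'X.
Let M : {poly A} := z%:P + g%:P * 'X.

(** The coefficient of s^j in b, of z-order r - j at least, contributes to the
    leading symbol of b of order r the term t^(r-j). So p is the leading
    symbol of b when z^k p_k and b_(r-k) agree modulo z^(k+1). Only k <= c
    matters, since z^(c+1) = 0; keeping r >= c makes all the r - k exact. *)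
Definition symbol_of r p b : Prop :=
  forall k, (k <= c)%N -> exists w, z ^+ k * p`_k = b`_(r - k) + z ^+ k.+1 * w.

Lemma coef_pencil_mul b k :
  (M * b)`_k = z * b`_k + (if k is k'.+1 then g * b`_k' else 0).
Proof.
rewrite mulrDl coefD coefCM -mulrA coefCM coefXM.
by case: k => [|k] //=; rewrite mulr0.
Qed.

(** Multiplication by z + s g acts on leading symbols as g + t. *)
Lemma symbol_of_mul r p b : (c <= r)%N ->
  symbol_of r p b -> symbol_of r.+1 (L * p) (M * b).
Proof.
move=> cr pb [|k] kc.
  have [w] := pb 0%N kc; rewrite !mul1r !subn0 expr1 => p0.
  exists (g * w - b`_r.+1); rewrite coef_CaddX_mul coef_pencil_mul addr0 p0.
  rewrite mulrDr mulrBr !mulrA (std_mulC stdA z g).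
  by rewrite [RHS]addrC addrA subrK addrC.
have [w1 p1] := pb k.+1 kc; have [w2 p2] := pb k (ltnW kc).
exists (g * w1 + w2); rewrite coef_CaddX_mul coef_pencil_mul subSS.
have -> : (r - k = (r - k.+1).+1)%N by lia.
move: p2; have -> : (r - k = (r - k.+1).+1)%N by lia.
move=> p2; rewrite mulrDr mulrA (std_mulC stdA _ g) -mulrA p1.
have -> : z ^+ k.+1 * p`_k = z * (z ^+ k * p`_k) by rewrite exprS mulrA.
have -> : z ^+ k.+2 * (g * w1 + w2) = g * (z ^+ k.+2 * w1) + z * (z ^+ k.+1 * w2).
  by rewrite mulrDr mulrA (std_mulC stdA _ g) -mulrA [z * (_ * w2)]mulrA -exprS.
rewrite p2 !mulrDr addrACA; congr (_ + _); exact: addrC.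
Qed.

Lemma symbol_of_exp d r p b : (c <= r)%N ->
  symbol_of r p b -> symbol_of (r + d) (L ^+ d * p) (M ^+ d * b).
Proof.
move=> cr pb; elim: d => [|d IH]; first by rewrite addn0 !mul1r.
by rewrite addnS !exprS -!mulrA; apply: symbol_of_mul => //; lia.
Qed.

Hypothesis symbol_inj : forall d e p, (d + e.*2)%N = c ->
  (forall k, bihomog gr e p k) ->
  (forall k, (k <= c)%N -> (L ^+ d * p)`_k \in annv z k) ->
  forall k, (k <= c)%N -> p`_k \in annv z k.

(** Multiply b by s^(c+1), which makes its order at least c, so that only
    symbols of order r >= c are used. If b has order r, its leading symbol is killed by (g + t)^d, hence
    it is zero and b has order r + 1. So b has infinite order; as z is
    nilpotent, b = 0. *)
Lemma pencil_inj d e b : (d + e.*2)%N = c -> (forall j, b`_j \in gr e) ->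
  M ^+ d * b = 0 -> b = 0.
Proof.
move=> def_c be Mb.
pose B := b * 'X^(c.+1).
have MB : M ^+ d * B = 0 by rewrite mulrA Mb mul0r.
have Be j : B`_j \in gr e by rewrite coefMXn; case: ifP; rewrite ?mem0v.
(* The order is written r = c + n. *)
suff zB n : forall j, (j <= c + n)%N -> exists w, B`_j = z ^+ (c + n - j) * w.
  have z0 j : B`_j = 0.
    have [w ->] := zB j.+1 j (ltac:(lia)).
    have -> : (c + j.+1 - j = c.+1)%N by lia.
    by rewrite (gr1_expr_eq0 stdA z1) mul0r.
  apply/polyP => j; have := z0 (j + c.+1)%N; rewrite coefMXn coef0.
  by rewrite ltnNge leq_addl addnK.
elim: n => [|n IH] j jr.
  by exists 0; rewrite mulr0 coefMXn ltnS; move: jr; rewrite addn0 => ->.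
set r := (c + n)%N in IH jr *.
(* Coefficients of the symbol: some preimage of b_(r-k) under z^k, replaced
   by its component of the right degree. *)
pose pk k := if (k <= e)%N
  then hcomp stdA (e - k) ((amull (z ^+ k))^-1%VF B`_(r - k)) else 0.
pose p := \poly_(k < c.+1) pk k.
have zp k : (k <= c)%N -> z ^+ k * p`_k = B`_(r - k).
  move=> kc; rewrite coef_poly ltnS kc /pk.
  have [w Bw] := IH (r - k)%N (leq_subr _ _).
  have imB : B`_(r - k) \in limg (amull (z ^+ k)).
    rewrite Bw subKn; last lia.
    by apply/memv_imgP; exists w; rewrite ?memvf // lfunE.
  have zk := grX stdA k z1; rewrite mul1n in zk.
  have Bw' : B`_(r - k) = z ^+ k * (amull (z ^+ k))^-1%VF B`_(r - k).
    by rewrite -{1}(limg_lfunVK imB) lfunE.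
  have := hcomp_homog stdA e (Be (r - k)%N).
  rewrite eqxx {1}Bw' (hcompM stdA _ _ zk) => Bk.
  by rewrite -[RHS]Bk; case: leqP => //; rewrite mulr0.
have pV : forall k, (k <= c)%N -> p`_k \in annv z k.
  apply: (@symbol_inj d e) => // [k|k kc].
    rewrite /bihomog coef_poly; case: ifP => _; last by rewrite mem0v.
    by rewrite /pk; case: ifP => _; rewrite ?hcomp_mem ?mem0v.
  have pB : symbol_of r p B by move=> i ic; exists 0; rewrite mulr0 addr0 zp.
  have [w] := @symbol_of_exp d r p B (leq_addr _ _) pB k kc.
  rewrite MB coef0 add0r exprSr -mulrA => Lp.
  apply/(annvP stdA); exists ((L ^+ d * p)`_k - z * w), w.
  by rewrite mulrBr Lp subrr subrK.
(* For j < r - c the order is already more than c, so that b_j is zero;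
   for j = r + 1 the exponent is 0; the symbol decides the other cases. *)
have [jlow|jhigh] := ltnP j (r - c).
  have [w ->] := IH j (ltac:(lia)).
  exists 0; rewrite mulr0; have -> : (r - j = (r - j - c.+1) + c.+1)%N by lia.
  by rewrite exprD (gr1_expr_eq0 stdA z1) mulr0 mul0r.
have [def_j|jltr] := eqVneq j r.+1.
  by exists B`_j; rewrite {2}def_j addnS subnn mul1r.
have kc : (r - j <= c)%N by lia.
have /(annvP stdA)[u [w [zu pE]]] := pV _ kc.
exists w; have := zp _ kc; rewrite pE mulrDr zu add0r subKn; last lia.
by move<-; rewrite mulrA -exprSr addnS subSn //; lia.
Qed.

End Degeneration.

(** * Specialization of polynomial families of linear maps *)
Section Genericity.
Variables (K : fieldType).

Lemma char0_nonroot (charK : [pchar K] =i pred0) (q : {poly K}) :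
  q != 0 -> exists l, q.[l] != 0.
Proof.
move=> q0; have inj : injective (fun n : nat => n%:R : K).
  suff le m n : (m <= n)%N -> m%:R = n%:R :> K -> m = n.
    move=> m n mn; case: (leqP m n) => [/le|/ltnW/le]; first exact.
    by move=> /(_ (esym mn)).
  move=> lemn /eqP; rewrite eq_sym -subr_eq0 -natrB // (pcharf0P _).1 //; lia.
have [/allP rootq|/allPn[l _]] := boolP (all (root q) [seq n%:R | n <- iota 0 (size q)]).
  have := max_poly_roots q0 (introT allP rootq); rewrite map_inj_uniq // iota_uniq.
  by rewrite size_map size_iota ltnn => /(_ isT).
by exists l.
Qed.

(** A right inverse B of the matrix at a gives the square matrix M B, with
    determinant 1 at a; this determinant is the required q. *)
Lemma row_free_open r n (M : 'M[{poly K}]_(r, n)) a :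
  row_free (map_mx (horner_eval a) M) ->
  exists2 q : {poly K}, q != 0 &
    forall l, q.[l] != 0 -> row_free (map_mx (horner_eval l) M).
Proof.
case/row_freeP => B MB1; pose N := M *m map_mx polyC B.
have NE l : map_mx (horner_eval l) N = map_mx (horner_eval l) M *m B.
  rewrite map_mxM -map_mx_comp; congr (_ *m _).
  by apply/matrixP=> i j; rewrite !mxE /= /horner_eval hornerC.
have detE l : (\det N).[l] = \det (map_mx (horner_eval l) M *m B).
  by rewrite -NE det_map_mx.
exists (\det N) => [|l].
  apply/eqP => det0; have := detE a; rewrite det0 horner0 MB1 det1.
  by move/esym/eqP; rewrite oner_eq0.
rewrite detE -unitfE -unitmxE => U; apply/row_freeP.
by exists (B *m invmx (map_mx (horner_eval l) M *m B)); rewrite mulmxA mulmxV.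
Qed.

Lemma row_free_generic r (M : 'M[{poly K}]_r) :
  (forall v : 'rV_r, v *m M = 0 -> v = 0) ->
  exists2 q : {poly K}, q != 0 &
    forall l, q.[l] != 0 -> row_free (map_mx (horner_eval l) M).
Proof.
move=> Minj; exists (\det M) => [|l Ml].
  by apply/det0P => -[v v0 /Minj]; apply/eqP.
by rewrite row_free_unit unitmxE unitfE det_map_mx.
Qed.

Variable (A : falgType K).

(** The matrix, in the basis X and the coordinates F, of the multiplication by
    the element P of A depending polynomially on a parameter. *)
Definition apply_mx r n (F : 'I_n -> {scalar A}) (X : r.-tuple A) (P : {poly A}) :
  'M[{poly K}]_(r, n) := \matrix_(i, j) map_poly (F j) (P * (X`_i)%:P).

Lemma horner_map_scalar (f : {scalar A}) (P : {poly A}) x l :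
  (map_poly f (P * x%:P)).[l] = f (P.[l%:A] * x).
Proof.
rewrite (@horner_coef_wide _ (size P)); last first.
  apply: leq_trans (size_poly _ _) _; apply: leq_trans (size_polyMleq _ _) _.
  by rewrite size_polyC; case: eqP => _; rewrite ?addn0 ?addn1 ?leq_pred.
rewrite horner_coef mulr_suml linear_sum; apply: eq_bigr => i _.
rewrite coef_map /= coefMC -[l%:A ^+ i]/((in_alg A l) ^+ i) -rmorphXn /=.
by rewrite -scalerAr mulr1 -scalerAl linearZ /= mulrC.
Qed.

Lemma row_free_apply_mx r n (F : 'I_n -> {scalar A}) (X : r.-tuple A) P l : free X ->
  reflect (forall x, x \in <<X>>%VS -> (forall j : 'I_n, F j (P.[l%:A] * x) = 0) -> x = 0)
          (row_free (map_mx (horner_eval l) (apply_mx F X P))).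
Proof.
move=> freeX.
have mulE (v : 'rV_r) j :
    (v *m map_mx (horner_eval l) (apply_mx F X P)) 0 j
      = F j (P.[l%:A] * \sum_i v 0 i *: X`_i).
  rewrite mxE mulr_sumr linear_sum; apply: eq_bigr => i _.
  by rewrite !mxE /horner_eval horner_map_scalar -scalerAr linearZ.
apply: (iffP idP) => [rfM x xX Fx | inj].
  have /row_free_inj inj := rfM.
  pose v := \row_i coord X i x.
  have def_x : x = \sum_i v 0 i *: X`_i.
    by rewrite {1}(coord_span xX); apply: eq_bigr => i _; rewrite mxE.
  have v0 : v = 0.
    by apply: inj; rewrite mul0mx; apply/rowP => j; rewrite mulE -def_x Fx mxE.
  by rewrite def_x v0 big1 // => i _; rewrite mxE scale0r.
apply: inj_row_free => v vM.
have x0 : \sum_i v 0 i *: X`_i = 0.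
  apply: inj => [|j]; last by rewrite -mulE vM mxE.
  by apply: memv_suml => i _; rewrite memvZ ?memv_span ?mem_nth ?size_tuple.
by move/freeP: freeX => /(_ (v 0) x0) v0; apply/rowP => i; rewrite v0 mxE.
Qed.

(** A kernel vector with polynomial entries is an element of A[s] that is
    killed by P, as far as the coordinates F can see. *)
Lemma apply_mx_kernel r n (F : 'I_n -> {scalar A}) (X : r.-tuple A) P (v : 'rV_r) :
  (v *m apply_mx F X P = 0) ->
  forall (j : 'I_n) k, F j ((P * \sum_i map_poly (in_alg A) (v 0 i) * (X`_i)%:P)`_k) = 0.
Proof.
move=> vM j k.
transitivity (((v *m apply_mx F X P) 0 j)`_k); last by rewrite vM mxE coef0.
rewrite mxE mulr_sumr !coef_sum linear_sum; apply: eq_bigr => i _.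
rewrite mxE mulrA (_ : P * _ = map_poly (in_alg A) (v 0 i) * P).
  rewrite -mulrA !coefM linear_sum; apply: eq_bigr => m _.
  by rewrite !coef_map /= -scalerAl mul1r linearZ.
apply/polyP => m; rewrite coefM coefMr; apply: eq_bigr => t _.
by rewrite !coef_map /= -scalerAl -scalerAr mulr1 mul1r.
Qed.

End Genericity.

(** * Conditions that are open along lines *)
Section OpenConditions.
Variables (K : fieldType) (charK : [pchar K] =i pred0) (A : falgType K).
Implicit Types (Q : A -> Prop) (S V : {vspace A}).

(** Zariski openness of Q, restricted to lines. This suffices to find common
    points, and only polynomials in one variable occur. *)
Definition line_open Q : Prop :=
  forall g h, Q g -> exists2 q : {poly K}, q != 0 &
    forall l, q.[l] != 0 -> Q (g + l *: h).

Lemma generic_forall (R : nat -> K -> Prop) N :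
  (forall i, (i < N)%N -> exists2 q : {poly K}, q != 0 & forall l, q.[l] != 0 -> R i l) ->
  exists2 q : {poly K}, q != 0 & forall l, q.[l] != 0 -> forall i, (i < N)%N -> R i l.
Proof.
elim: N => [|N IH] Rq; first by exists 1; rewrite ?oner_neq0.
have [|q q0 qR] := IH; first by move=> i iN; apply/Rq/ltnW.
have [q' q'0 q'R] := Rq N (leqnn _).
exists (q * q') => [|l]; first exact: mulf_neq0.
rewrite hornerM mulf_eq0 negb_or => /andP[ql q'l] i.
by rewrite ltnS leq_eqVlt => /predU1P[->|]; [apply: q'R | apply: qR].
Qed.

(** On the line through a point g of the first conditions and a point g' of
    the last one, each condition excludes finitely many points, and K is
    infinite. *)
Lemma line_open_common V (Q : nat -> A -> Prop) N :
  (forall i, (i < N)%N -> line_open (Q i)) ->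
  (forall i, (i < N)%N -> exists2 g, g \in V & Q i g) ->
  exists2 g, g \in V & forall i, (i < N)%N -> Q i g.
Proof.
elim: N => [|N IH] openQ exQ; first by exists 0; rewrite ?mem0v.
have [i iN|i iN|g gV Qg] := IH; [exact/openQ/ltnW | exact/exQ/ltnW|].
have [g' g'V Qg'] := exQ N (leqnn _).
have [|q q0 qQ] := @generic_forall (fun i l => Q i (g + l *: (g' - g))) N.
  by move=> i iN; apply: (openQ i (ltnW iN)); apply: Qg.
have [q' q'0 q'Q] := openQ N (leqnn _) g' (g - g') Qg'.
have sz2 : size (1 - 'X : {poly K}) = 2.
  by rewrite -opprB size_polyN size_XsubC.
have [|l] := @char0_nonroot K charK (q * (q' \Po (1 - 'X))).
  by rewrite mulf_neq0 ?comp_poly2_eq0.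
(* The last condition is parametrized from the other end of the line. *)
rewrite hornerM mulf_eq0 negb_or horner_comp !hornerE => /andP[ql q'l].
exists (g + l *: (g' - g)); first by rewrite memvD ?memvZ ?memvB.
move=> i; rewrite ltnS leq_eqVlt => /predU1P[->|iN]; last exact: qQ.
have := q'Q _ q'l; congr (Q N _).
by rewrite scalerBl scale1r -(opprB g g') scalerN addrA subrKC.
Qed.

Lemma line_openI (Q : nat -> A -> Prop) N :
  (forall i, (i < N)%N -> line_open (Q i)) ->
  line_open (fun g => forall i, (i < N)%N -> Q i g).
Proof. by move=> openQ g h Qg; apply: generic_forall => i iN; apply/openQ/Qg. Qed.

Lemma horner_pencil (u v : A) n l :
  ((u%:P + v%:P * 'X) ^+ n).[l%:A] = (u + l *: v) ^+ n.
Proof.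
have cp (p : {poly A}) : comm_poly p l%:A.
  by rewrite /comm_poly -scalerAl -scalerAr mul1r mulr1.
rewrite horner_exp_comm // hornerD hornerC hornerM_comm // hornerC hornerX.
by rewrite -scalerAr mulr1.
Qed.

(** The condition says that multiplication by g^n is injective from S / (S
    meet V) to A / V. A complement of S meet V in S and the projection along V
    turn it into the independence of the rows of a matrix. *)
Lemma line_open_injective_mod S V n :
  (forall a x, x \in V -> a * x \in V) ->
  line_open (fun g => forall x, x \in S -> g ^+ n * x \in V -> x \in V).
Proof.
move=> idealV g h injg.
pose X := vbasis (S :\: V); pose Y := vbasis {:A}.
pose F j : {scalar A} := coord Y j \o (\1 - projv V)%VF.
have FV x : (forall j, F j x = 0) -> x \in V.
  move=> Fx; rewrite -[x](subrK (projv V x)) memvD ?memv_proj //.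
  rewrite (coord_vbasis (memvf (x - _))) memv_suml // => j _.
  by have := Fx j; rewrite /= !lfunE /= !lfunE /= => ->; rewrite scale0r mem0v.
have VF x j : x \in V -> F j x = 0.
  by move=> xV; rewrite /= !lfunE /= !lfunE /= projv_id // subrr linear0.
pose M := apply_mx F X ((g%:P + h%:P * 'X) ^+ n).
have freeX : free X := basis_free (vbasisP _).
have spanX : <<X>>%VS = (S :\: V)%VS := span_basis (vbasisP _).
have diffI x : x \in (S :\: V)%VS -> x \in V -> x = 0.
  by move=> xD xV; apply/eqP; rewrite -memv0 -(capv_diff S V) memv_cap xD.
have [|q q0 qM] := @row_free_open K _ _ M 0.
  apply/row_free_apply_mx => // x; rewrite spanX horner_pencil scale0r addr0.
  move=> xD /FV/injg xV; apply: diffI => //; apply: xV.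
  by apply: subvP xD; rewrite diffvSl.
exists q => // l /qM /(row_free_apply_mx _ _ _ freeX).
rewrite spanX horner_pencil => injl x xS xV.
move: xS; rewrite -{1}(addv_diff_cap S V) => /memv_addP[y yD [w]].
rewrite memv_cap => /andP[_ wV] def_x; move: xV; rewrite def_x mulrDr.
rewrite (rpredDr _ (idealV _ w wV)) => yV; rewrite (rpredDr _ wV).
by rewrite (injl y yD) ?mem0v // => j; apply: VF.
Qed.

End OpenConditions.

(** * From the quotients V_(m+1) / V_m to A *)
Section LefschetzFromCentralSimpleModules.
Variables (K : fieldType) (charK : [pchar K] =i pred0) (A : falgType K).
Variables (gr : nat -> {vspace A}) (c : nat).
Hypotheses (stdA : standard_graded_artinian gr c) (gorA : gorenstein gr).

(** Surjectivity comes from the equality of the dimensions in degrees e and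
    c - e. *)
Lemma SLP_of_injective g : g \in gr 1 ->
  (forall d e x, (d + e.*2)%N = c -> x \in gr e -> g ^+ d * x = 0 -> x = 0) ->
  algebra_SLP gr c.
Proof.
move=> g1 injg; exists g => // e ec.
have def_c : (c - e.*2 + e.*2 = c)%N by lia.
have gX x : x \in gr e -> g ^+ (c - e.*2) * x \in gr (c - e)%N.
  have -> : (c - e = (c - e.*2) + e)%N by lia.
  by move=> xe; apply: (grM stdA) => //; have := grX stdA (c - e.*2) g1; rewrite mul1n.
split=> // [x y xe ye /eqP|y yc].
  rewrite -subr_eq0 -mulrBr => /eqP gxy; apply/eqP; rewrite -subr_eq0; apply/eqP.
  by apply: (injg _ e _ def_c) gxy; rewrite memvB.
pose f := amull (g ^+ (c - e.*2)).
have fE x : f x = g ^+ (c - e.*2) * x by rewrite lfunE.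
have : y \in (f @: gr e)%VS; last first.
  by case/memv_imgP => x xe ->; exists x; rewrite ?fE.
suff -> : (f @: gr e)%VS = gr (c - e)%N by [].
apply/eqP; rewrite eqEdim; apply/andP; split.
  by apply/subvP => _ /memv_imgP[x xe ->]; rewrite fE gX.
rewrite limg_dim_eq; first by rewrite -(dim_gr_sym stdA gorA (j := e)) //; lia.
apply/eqP; rewrite -subv0; apply/subvP => x; rewrite memv_cap memv_ker fE memv0.
by case/andP=> xe /eqP gx; apply/eqP; apply: (injg _ e _ def_c).
Qed.

Lemma SLP_of_central_simple_modules z : z \in gr 1 ->
  (forall m, (m <= c)%N -> exists2 g, g \in gr 1 &
     forall n i x, (n + i.*2 + m)%N = c -> x \in gr i -> x \in annv z m.+1 ->
       g ^+ n * x \in annv z m -> x \in annv z m) ->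
  algebra_SLP gr c.
Proof.
move=> z1 csm.
(* For m + 2i > c the condition is made trivial by replacing V_m by A. *)
pose Q m g := forall i, (i < c.+1)%N ->
  forall x, x \in (annv z m.+1 :&: gr i)%VS ->
  g ^+ (c - m - i.*2) * x \in (if (m + i.*2 <= c)%N then annv z m else fullv) ->
  x \in (if (m + i.*2 <= c)%N then annv z m else fullv).
(* One g that works for all the quotients. *)
have [m mc|m|g g1 gQ] := @line_open_common _ charK _ (gr 1) Q c.+1.
- apply: line_openI => i ic; apply: line_open_injective_mod => a x.
  by case: ifP => _ xV; [apply: (annvM stdA) | apply: memvf].
- rewrite ltnS => /csm[g g1 ginj]; exists g => // i ic x.
  rewrite memv_cap => /andP[xV xi]; case: ifP => [mi|_]; last by rewrite memvf.
  by apply: ginj => //; lia.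
have sym_inj d e p : (d + e.*2)%N = c -> (forall k, bihomog gr e p k) ->
    (forall k, (k <= c)%N -> ((g%:P + 'X) ^+ d * p)`_k \in annv z k) ->
    forall k, (k <= c)%N -> p`_k \in annv z k.
  apply: (filtered_string_injective charK) => [i x xi|m x|m||m n i x def_c xV xi].
  - by have := grM stdA g1 xi.
  - exact: (annvM stdA).
  - exact: (annvS stdA).
  - exact: (annv_full stdA).
  have := gQ m (ltac:(lia)) i (ltac:(lia)) x; rewrite memv_cap xV xi.
  have -> : (m + i.*2 <= c)%N by lia.
  have -> : (c - m - i.*2 = n)%N by lia.
  exact.
(* It is enough to exclude finitely many values of s for each degree e. *)
have [e ec|q q0 qinj] := @generic_forall K (fun e l =>
    (e.*2 <= c)%N -> forall x, x \in gr e ->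
    (z + l *: g) ^+ (c - e.*2) * x = 0 -> x = 0) c.+1; last first.
  have [l ql] := char0_nonroot charK q0.
  apply: (@SLP_of_injective (z + l *: g)); first by rewrite memvD ?memvZ.
  move=> d e x def_c xe gx; apply: (qinj l ql e) => //; [lia | lia |].
  by have -> : (c - e.*2 = d)%N by lia.
have [e2c|] := leqP e.*2 c; last by exists 1; rewrite ?oner_neq0.
pose X := vbasis (gr e); pose Y := vbasis (gr (c - e)).
have eqdim := dim_gr_sym stdA gorA (ec : (e <= c)%N).
pose F j : {scalar A} := coord Y (cast_ord eqdim j).
pose P := (z%:P + g%:P * 'X) ^+ (c - e.*2).
have freeX : free X := basis_free (vbasisP _).
have spanX : <<X>>%VS = gr e := span_basis (vbasisP _).
have PM (b : {poly A}) d : (forall k, b`_k \in gr e) ->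
    forall k, ((z%:P + g%:P * 'X) ^+ d * b)`_k \in gr (d + e).
  move=> be; elim: d => [|d IH] k; first by rewrite mul1r.
  rewrite exprS -mulrA coef_pencil_mul; apply: memvD.
    by have := grM stdA z1 (IH k); rewrite add1n.
  by case: k => [|k]; rewrite ?mem0v //; have := grM stdA g1 (IH k); rewrite add1n.
have [|q q0 qM] := @row_free_generic K _ (apply_mx F X P).
  move=> v vM; pose b := \sum_i map_poly (in_alg A) (v 0 i) * (X`_i)%:P.
  have bE k : b`_k = \sum_i (v 0 i)`_k *: X`_i.
    rewrite coef_sum; apply: eq_bigr => i _.
    by rewrite coefMC coef_map /= -scalerAl mul1r.
  have be k : b`_k \in gr e.
    rewrite bE memv_suml // => i _; rewrite memvZ // vbasis_mem //.
    by rewrite mem_nth // size_tuple.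
  have b0 : b = 0.
    apply: (pencil_inj stdA z1 sym_inj (d := (c - e.*2)%N) _ be); first lia.
    apply/polyP => k; rewrite coef0.
    have := PM b (c - e.*2)%N be k; have -> : (c - e.*2 + e = c - e)%N by lia.
    move/coord_vbasis => ->; rewrite big1 // => j _.
    have := apply_mx_kernel vM (cast_ord (esym eqdim) j) k.
    by rewrite /F /= cast_ordKV => ->; rewrite scale0r.
  apply/rowP => i; rewrite mxE; apply/polyP => k; rewrite coef0.
  have /freeP indep := freeX.
  by have := indep (fun i => (v 0 i)`_k); rewrite -bE b0 coef0; apply.
exists q => // l /qM /(row_free_apply_mx _ _ _ freeX).
rewrite spanX horner_pencil => injl _ x xe gx; apply: injl => // j.
by rewrite gx linear0.
Qed.

End LefschetzFromCentralSimpleModules.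

(** * Jordan bases as chains *)
Section JordanChains.
Variables (K : fieldType) (A : falgType K).
Hypothesis mulC : forall x y : A, x * y = y * x.
Variable z : A.

Let act : {poly K} -> A := horner_alg z.

Lemma actXn n : act 'X^n = z ^+ n.
Proof. by rewrite /act rmorphXn /= horner_algX. Qed.

Lemma actD p q : act (p + q) = act p + act q.
Proof. exact: rmorphD. Qed.

Lemma actZ a q : act (a *: q) = a *: act q.
Proof. by rewrite -mul_polyC /act rmorphM /= horner_algC mulr_algl. Qed.

Lemma actC a : act a%:P = a%:A.
Proof. exact: horner_algC. Qed.

Lemma act_sum n (F : 'I_n -> {poly K}) : act (\sum_i F i) = \sum_i act (F i).
Proof. exact: rmorph_sum. Qed.

Lemma actE q : act q = \sum_(i < size q) q`_i *: z ^+ i.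
Proof.
rewrite -{1}[q]coefK poly_def /act linear_sum; apply: eq_bigr => i _.
by rewrite -[LHS]/(act _) actZ actXn.
Qed.

(** A decomposition of W as a direct sum of cyclic K[X]-modules
    K[X] v_k = K[X] / X^(p_k), where X acts as z. Coefficients in K[X] of
    bounded degree replace the double indexing of a Jordan basis. *)
Record chain_basis (I : finType) (v : I -> A) (p : I -> nat) (W : {vspace A}) : Prop :=
  ChainBasis {
    chain_gt0 : forall k, (0 < p k)%N;
    chain_top : forall k, v k \in W;
    chain_end : forall k, z ^+ p k * v k = 0;
    chain_span : forall x, x \in W -> exists q : I -> {poly K},
      (forall k, size (q k) <= p k)%N /\ x = \sum_k act (q k) * v k;
    chain_free : forall q : I -> {poly K}, (forall k, size (q k) <= p k)%N ->
      \sum_k act (q k) * v k = 0 -> forall k, q k = 0 }.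

(** The induction step of the Jordan normal form: lift the tops v_k of the
    chains of zW to elements u_k of W, which makes every chain one longer, and
    add chains of length one on a complement, in the kernel of z on W, of the
    span of the bottoms t_k = z^(p_k) u_k. *)
Lemma chain_basis_step (W : {vspace A}) (I : finType) v p :
  (forall x, x \in W -> z * x \in W) ->
  @chain_basis I v p (amull z @: W)%VS ->
  exists (J : finType) (v' : J -> A) p', @chain_basis J v' p' W.
Proof.
move=> zW cb.
have [u uW vE] : exists2 u : I -> A, forall k, u k \in W & forall k, v k = z * u k.
  apply: (@fin_all_exists2 _ _ (fun k x => x \in W) (fun k x => v k = z * x)) => k.
  by have /memv_imgP[x xW ->] := chain_top cb k; exists x; rewrite ?lfunE.
have znW n x : x \in W -> z ^+ n * x \in W.
  by move=> xW; elim: n => [|n IH]; rewrite ?mul1r // exprS -mulrA zW.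
have actW q x : x \in W -> act q * x \in W.
  move=> xW; rewrite actE mulr_suml memv_suml // => i _.
  by rewrite -scalerAl memvZ ?znW.
pose t k := z ^+ p k * u k.
pose Kz := (W :&: lker (amull z))%VS.
have memKz x : (x \in Kz) = (x \in W) && (z * x == 0).
  by rewrite memv_cap memv_ker lfunE.
have tKz k : t k \in Kz.
  by rewrite memKz znW //= mulrA -exprS exprSr -mulrA -vE (chain_end cb).
pose T := (\sum_k <[t k]>)%VS; pose Y := vbasis (Kz :\: T).
have freeY : free Y := basis_free (vbasisP _).
have YK i : Y`_i \in (Kz :\: T)%VS.
  have [ltis|] := ltnP i (size Y); first by rewrite vbasis_mem // mem_nth.
  by move/(nth_default 0)->; rewrite mem0v.
have zY i : z * Y`_i = 0.
  by have := subvP (diffvSl _ _) _ (YK i); rewrite memKz => /andP[_ /eqP].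
have YW i : Y`_i \in W.
  by have := subvP (diffvSl _ _) _ (YK i); rewrite memKz => /andP[].
(* The t_k are the bottoms of the given chains, hence independent. *)
have tindep a : \sum_k a k *: t k = 0 -> forall k, a k = 0.
  move=> at0 k.
  have := chain_free cb (q := fun k => a k *: 'X^((p k).-1)) _ _ k.
  have pk k' := prednK (chain_gt0 cb k').
  move=> /(_ _ _)/polyP/(_ (p k).-1); rewrite coefZ coefXn eqxx mulr1 coef0; apply.
    by move=> k'; rewrite (leq_trans (size_scale_leq _ _)) // size_polyXn pk.
  rewrite -[RHS]at0; apply: eq_bigr => k' _.
  by rewrite actZ actXn -scalerAl vE mulrA -exprSr pk.
pose v' (j : I + 'I_(\dim (Kz :\: T))) :=
  match j with inl k => u k | inr i => Y`_i end.
pose p' (j : I + 'I_(\dim (Kz :\: T))) :=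
  match j with inl k => (p k).+1 | inr i => 1%N end.
exists (I + 'I_(\dim (Kz :\: T)))%type, v', p'; split=> [[]|[]|[k|i]|x xW|q szq].
- by [].
- by [].
- exact: uW.
- exact: YW.
- by rewrite /= exprSr -mulrA -vE (chain_end cb).
- by rewrite /= expr1.
- have [|q [szq zxE]] := chain_span cb (x := z * x).
    by apply/memv_imgP; exists x; rewrite // lfunE.
  have: x - \sum_k act (q k) * u k \in Kz.
    rewrite memKz memvB ?memv_suml //= => [|k _]; last exact: actW.
    rewrite mulrBr zxE mulr_sumr -sumrB big1 // => k _.
    by rewrite vE mulrA (mulC _ z) mulrA subrr.
  rewrite -{1}(addv_diff_cap Kz T) => /memv_addP[y yD [w]].
  rewrite memv_cap => /andP[_ /memv_sumP[ws wsT ->]] /eqP.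
  rewrite subr_eq => /eqP xE.
  have [a aE] : exists a : I -> K, forall k, ws k = a k *: t k.
    by apply: (@fin_all_exists _ _ (fun k a => ws k = a *: t k)) => k; apply/vlineP/wsT.
  exists (fun j => match j with
    inl k => q k + a k *: 'X^(p k) | inr i => (coord Y i y)%:P end); split.
    case=> [k|i] /=; last by rewrite size_polyC leq_b1.
    rewrite (leq_trans (size_polyD _ _)) // geq_max (leq_trans (szq k)) //=.
    by rewrite (leq_trans (size_scale_leq _ _)) // size_polyXn.
  rewrite xE big_sumType /= {1}(coord_vbasis yD) -addrA addrC; congr (_ + _).
    rewrite addrC -big_split; apply: eq_bigr => k _ /=.
    rewrite actD actZ actXn mulrDl.
    by rewrite aE -scalerAl.
  by apply: eq_bigr => i _; rewrite actC -scalerAl mul1r.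
rewrite big_sumType /= => sum0.
have qinr i : q (inr i) = ((q (inr i))`_0)%:P by apply: size1_polyC; apply: szq (inr i).
have qinl k : q (inl k) = take_poly (p k) (q (inl k)) + (q (inl k))`_(p k) *: 'X^(p k).
  rewrite -{1}(poly_take_drop (p k) (q (inl k))); congr (_ + _).
  rewrite [drop_poly _ _]size1_polyC ?coef_drop_poly ?mul_polyC //.
  by rewrite size_drop_poly; have := szq (inl k); rewrite /=; lia.
(* Multiplication by z kills the new chains and the terms of degree p_k, and
   leaves a relation between the v_k. *)
have take0 k : take_poly (p k) (q (inl k)) = 0.
  apply: (chain_free cb (q := fun k => take_poly (p k) (q (inl k)))) => [j|].
    exact: size_take_poly.
  have zsum : \sum_k z * (act (q (inl k)) * u k) = 0.
    have := congr1 (fun x => z * x) sum0; rewrite /= mulr0 mulrDr !mulr_sumr.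
    rewrite [X in _ + X]big1 ?addr0 // => i _.
    by rewrite mulrA (mulC z) -mulrA zY mulr0.
  rewrite -[RHS]zsum; apply: eq_bigr => j _.
  rewrite mulrA (mulC z) -mulrA -vE {2}qinl.
  rewrite actD actZ actXn mulrDl -scalerAl.
  by rewrite (chain_end cb) scaler0 addr0.
have qk k : act (q (inl k)) * u k = (q (inl k))`_(p k) *: t k.
  by rewrite {1}qinl take0 add0r actZ actXn -scalerAl.
have qi i : act (q (inr i)) * Y`_i = (q (inr i))`_0 *: Y`_i.
  by rewrite {1}qinr actC -scalerAl mul1r.
rewrite (eq_bigr _ (fun k _ => qk k)) (eq_bigr _ (fun i _ => qi i)) in sum0.
have yT : \sum_i (q (inr i))`_0 *: Y`_i \in T.
  move/eqP: sum0; rewrite addrC addr_eq0 => /eqP->.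
  rewrite memvN; apply/memv_sumP.
  by exists (fun k => (q (inl k))`_(p k) *: t k) => // k _; rewrite memvZ ?memv_line.
have y0 : \sum_i (q (inr i))`_0 *: Y`_i = 0.
  apply/eqP; rewrite -memv0 -(capv_diff Kz T) memv_cap yT andbT.
  by rewrite memv_suml // => i _; rewrite memvZ.
rewrite y0 addr0 in sum0.
case=> [k|i].
  by rewrite qinl take0 add0r (tindep (fun k => (q (inl k))`_(p k)) sum0) scale0r.
have /freeP indep := freeY.
by rewrite qinr (indep (fun i => (q (inr i))`_0) y0).
Qed.


Lemma chain_basis_exists n (W : {vspace A}) :
  (forall x, x \in W -> z * x \in W) -> (forall x, x \in W -> z ^+ n * x = 0) ->
  exists (I : finType) (v : I -> A) p, chain_basis v p W.
Proof.
elim: n W => [|n IH] W zW nW.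
  exists void, (of_void A), (of_void nat).
  split=> [[]|[]|[]|x xW|q _ _ []]; exists (of_void _); split; first by case.
  by rewrite big_pred0 => [|[]]; rewrite -[LHS]mul1r nW.
have zW' x : x \in (amull z @: W)%VS -> exists2 y, y \in W & x = z * y.
  by case/memv_imgP => y yW ->; exists y; rewrite ?lfunE.
have [x /zW'[y yW ->]|x /zW'[y yW ->]|I [v [p cb]]] := IH (amull z @: W)%VS.
- by apply/memv_imgP; exists (z * y); rewrite ?zW ?lfunE.
- by rewrite mulrA -exprSr nW.
exact: chain_basis_step cb.
Qed.

Lemma chain_basis_ord (W : {vspace A}) (I : finType) (v : I -> A) p :
  chain_basis v p W ->
  exists r (v' : 'I_r -> A) p', chain_basis v' p' W.
Proof.
move=> cb; exists #|I|, (fun i => v (enum_val i)), (fun i => p (enum_val i)).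
have bij : {on [pred i | predT i], bijective (@enum_val I predT)}.
  exact: onW_bij (enum_val_bij _).
split=> [k|k|k|x /(chain_span cb)[q [szq ->]]|q szq sum0 k].
- exact: chain_gt0 cb _.
- exact: chain_top cb _.
- exact: chain_end cb _.
- exists (fun i => q (enum_val i)); split=> [k|]; first exact: szq.
  by rewrite (reindex _ bij).
have := chain_free cb (q := fun i => q (enum_rank i)) _ _ (enum_val k).
rewrite enum_valK; apply=> [i|].
  by have := szq (enum_rank i); rewrite enum_rankK.
rewrite (reindex _ bij) /= -[RHS]sum0.
by apply: eq_bigr => i _; rewrite enum_valK.
Qed.

Section JordanForm.
Variables (r : nat) (p : 'I_r -> nat).

Lemma sum_Rank (V : nmodType) (F : 'I_(\sum_k p k) -> V) :
  \sum_s F s = \sum_k \sum_(j < p k) F (tagnat.Rank k j).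
Proof.
rewrite sig_big_dep /= (reindex _ tagnat.sig_bij_on) /=.
by apply: eq_bigr => s _; rewrite tagnat.sig2K.
Qed.

Lemma mxdiag_Rank (B : forall k, 'M[K]_(p k)) k i k' j :
  (\mxdiag_k B k) (tagnat.Rank k i) (tagnat.Rank k' j)
    = (if k == k' then conform_mx 0 (B k) else 0) i j.
Proof.
rewrite -(mxblockK (fun j k => if j == k then conform_mx 0 (B j) else 0) k k').
by rewrite !mxE.
Qed.

(** The matrix of a Jordan block sends each basis vector to the previous one,
    so the top of a chain is the last vector of its block. *)
Definition jordan_tuple (v : 'I_r -> A) : (\sum_k p k).-tuple A :=
  [tuple z ^+ (p (tagnat.sig1 s) - (tagnat.sig2 s).+1) * v (tagnat.sig1 s) | s < \sum_k p k].

Lemma jordan_tuple_Rank v k (j : 'I_(p k)) :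
  tnth (jordan_tuple v) (tagnat.Rank k j) = z ^+ (p k - j.+1) * v k.
Proof.
rewrite tnth_mktuple tagnat.Rank2K; move: (esym _).
by rewrite tagnat.Rank1K => eqk; rewrite /=.
Qed.

Lemma mxdiag_jordan_sum (e : (\sum_k p k).-tuple A) k (j : 'I_(p k)) :
  \sum_s (\mxdiag_k jordan_block K (p k)) s (tagnat.Rank k j) *: tnth e s
    = \sum_(i < p k | j == i.+1 :> nat) tnth e (tagnat.Rank k i).
Proof.
rewrite sum_Rank (bigD1 k) //= [X in _ + X]big1 ?addr0 => [|k' k'k].
  rewrite [RHS]big_mkcond /=; apply: eq_bigr => i _.
  rewrite mxdiag_Rank eqxx conform_mx_id mxE.
  by case: eqP; rewrite ?scale1r ?scale0r.
by rewrite big1 // => i _; rewrite mxdiag_Rank (negPf k'k) mxE scale0r.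
Qed.

(** The polynomials that collect the coordinates of a vector block by block;
    the exponents run backwards as in [jordan_tuple]. *)
Definition chain_poly (a : 'I_(\sum_k p k) -> K) k : {poly K} :=
  \sum_(j < p k) a (tagnat.Rank k j) *: 'X^(p k - j.+1).

Lemma coef_chain_poly a k (j : 'I_(p k)) :
  (chain_poly a k)`_(p k - j.+1) = a (tagnat.Rank k j).
Proof.
rewrite coef_sum (bigD1 j) //= coefZ coefXn eqxx mulr1 big1 ?addr0 // => i ij.
rewrite coefZ coefXn; have -> : (p k - j.+1 == p k - i.+1)%N = false.
  by apply/negbTE; move: ij (ltn_ord i) (ltn_ord j); rewrite -val_eqE /=; lia.
by rewrite mulr0.
Qed.

Lemma size_chain_poly a k : (size (chain_poly a k) <= p k)%N.
Proof.
apply: (leq_trans (size_sum _ _ _)); apply/bigmax_leqP => j _.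
rewrite (leq_trans (size_scale_leq _ _)) // size_polyXn.
by have := ltn_ord j; lia.
Qed.

Lemma chain_polyP (q : 'I_r -> {poly K}) : (forall k, (size (q k) <= p k)%N) ->
  exists a, forall k, q k = chain_poly a k.
Proof.
move=> szq; pose a s := (q (tagnat.sig1 s))`_(p (tagnat.sig1 s) - (@tagnat.sig2 _ p s).+1).
exists a => k; apply/polyP => i; have [ik|ki] := ltnP i (p k); last first.
  by rewrite !nth_default // (leq_trans _ ki) // size_chain_poly.
have jk : (p k - i.+1 < p k)%N by lia.
have -> : i = (p k - (Ordinal jk).+1)%N by rewrite /=; lia.
rewrite coef_chain_poly /a tagnat.Rank2K; move: (esym _).
by rewrite tagnat.Rank1K.
Qed.

Lemma jordan_tuple_sum v a :
  \sum_s a s *: tnth (jordan_tuple v) s = \sum_k act (chain_poly a k) * v k.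
Proof.
rewrite sum_Rank; apply: eq_bigr => k _.
rewrite /chain_poly act_sum mulr_suml; apply: eq_bigr => j _.
by rewrite jordan_tuple_Rank actZ actXn scalerAl.
Qed.

Lemma jordan_tuple_sum_nth v a :
  \sum_(s < \sum_k p k) a s *: (jordan_tuple v)`_s
    = \sum_k act (chain_poly a k) * v k.
Proof.
by rewrite -jordan_tuple_sum; apply: eq_bigr => s _; rewrite (tnth_nth 0).
Qed.

Lemma chain_basis_jordan_tuple v : (forall k, (0 < p k)%N) ->
  (forall k, z ^+ p k * v k = 0) ->
  chain_basis v p fullv <-> basis_of fullv (jordan_tuple v).
Proof.
move=> p0 zv; split=> [cb|be].
  apply/andP; split.
    rewrite eqEsubv subvf; apply/subvP => x xf.
    have [q [/chain_polyP[a qa] ->]] := chain_span cb xf.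
    rewrite (_ : \sum_k _ = \sum_k act (chain_poly a k) * v k); last first.
      by apply: eq_bigr => k _; rewrite qa.
    rewrite -jordan_tuple_sum memv_suml // => s _.
    by rewrite memvZ // memv_span // mem_tnth.
  apply/freeP => a; rewrite jordan_tuple_sum_nth => sum0 s.
  have := chain_free cb (fun k => size_chain_poly a k) sum0 (tagnat.sig1 s).
  move/polyP/(_ (p (tagnat.sig1 s) - (tagnat.sig2 s).+1)%N).
  by rewrite coef_chain_poly tagnat.sig2K coef0.
split=> // [k|x xf|q szq]; first by rewrite memvf.
- exists (chain_poly (fun s => coord (jordan_tuple v) s x)); split=> [k|].
    exact: size_chain_poly.
  by rewrite -jordan_tuple_sum_nth -(coord_basis be xf).
have [a qa] := chain_polyP szq.
rewrite (_ : \sum_k _ = \sum_k act (chain_poly a k) * v k); last first.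
  by apply: eq_bigr => k _; rewrite qa.
rewrite -jordan_tuple_sum_nth => sum0 k.
have /freeP/(_ a sum0) a0 := basis_free be; rewrite qa /chain_poly big1 // => j _.
by rewrite a0 scale0r.
Qed.

Lemma jordan_form_chain_basis :
  jordan_form (amulr z) p <-> exists v, chain_basis v p fullv.
Proof.
split=> [[p0 [e [be he]]]|[v cb]]; last first.
  split; first exact: chain_gt0 cb.
  exists (jordan_tuple v); split.
    by apply/chain_basis_jordan_tuple => //; [apply: chain_gt0 cb | apply: chain_end cb].
  move=> s; rewrite -(tagnat.sig2K s); set k := tagnat.sig1 s; set j := tagnat.sig2 s.
  rewrite mxdiag_jordan_sum lfunE /= mulC jordan_tuple_Rank mulrA -exprS.
  case: (posnP j) => [j0|jpos].
    rewrite big_pred0 => [|i]; last by rewrite j0.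
    by rewrite j0 subn1 prednK ?(chain_gt0 cb) // (chain_end cb).
  have ij : (j.-1 < p k)%N by rewrite (leq_ltn_trans (leq_pred j)).
  rewrite (big_pred1 (Ordinal ij)) => [|i]; last first.
    by apply/eqP/eqP => [ji|->]; [apply: val_inj; rewrite /= ji | rewrite /= prednK].
  by rewrite jordan_tuple_Rank /= prednK // subnSK.
(* Basis vectors indexed by natural numbers, to subtract from the index. *)
pose E k i : A := if insub i is Some j then tnth e (tagnat.Rank k j) else 0.
have EE k (j : 'I_(p k)) : E k j = tnth e (tagnat.Rank k j) by rewrite /E valK.
have zE k (j : 'I_(p k)) :
    z * E k j = \sum_(i < p k | j == i.+1 :> nat) E k i.
  rewrite EE; have := he (tagnat.Rank k j); rewrite lfunE /= mulC => ->.
  by rewrite mxdiag_jordan_sum; apply: eq_bigr => i _; rewrite EE.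
pose v k := E k (p k).-1.
have Ev k n : (n < p k)%N -> E k (p k - n.+1)%N = z ^+ n * v k.
  elim: n => [|n IH] np; first by rewrite subn1 mul1r.
  rewrite exprS -mulrA -IH; last lia.
  have jp : (p k - n.+1 < p k)%N by lia.
  have ip : (p k - n.+2 < p k)%N by lia.
  rewrite -[(p k - n.+1)%N]/(nat_of_ord (Ordinal jp)) zE (big_pred1 (Ordinal ip)) //.
  by move=> i; apply/eqP/eqP => [/= ji|->]; [apply: val_inj | ]; rewrite /=; lia.
have eE : e = jordan_tuple v.
  apply: eq_from_tnth => s; rewrite -(tagnat.sig2K s) jordan_tuple_Rank.
  rewrite -EE -Ev; have := ltn_ord (tagnat.sig2 s); last lia.
  by move=> sp; congr (E _ _); lia.
exists v; apply/chain_basis_jordan_tuple; rewrite -?eE // => k.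
rewrite -(prednK (p0 k)) exprS -mulrA -Ev ?prednK // subnn.
rewrite -[0%N]/(nat_of_ord (Ordinal (p0 k))) zE big_pred0 // => i.
Qed.

End JordanForm.

End JordanChains.

(** * Central simple modules *)
Section CentralSimpleModules.
Variables (K : fieldType) (A : falgType K) (gr : nat -> {vspace A}) (c : nat).
Hypotheses (stdA : standard_graded_artinian gr c).
Variable z : A.

Section ChainAnnihilators.
Variables (I : finType) (v : I -> A) (p : I -> nat).
Hypothesis cb : chain_basis z v p fullv.

Lemma horner_alg_take k q :
  horner_alg z (take_poly (p k) q) * v k = horner_alg z q * v k.
Proof.
rewrite -[in RHS](poly_take_drop (p k) q) rmorphD rmorphM /= mulrDl.
by rewrite rmorphXn /= horner_algX -[_ * _ * v k]mulrA (chain_end cb) mulr0 addr0.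
Qed.

(** Coordinates are unique modulo X^(p_k), since X^(p_k) kills v_k. *)
Lemma chain_coord (q : I -> {poly K}) (s : I -> {poly K}) :
  (forall k, size (q k) <= p k)%N ->
  \sum_k horner_alg z (q k) * v k = \sum_k horner_alg z (s k) * v k ->
  forall k, q k = take_poly (p k) (s k).
Proof.
move=> szq qs k; apply/eqP; rewrite -subr_eq0; apply/eqP.
apply: (chain_free cb (q := fun k => q k - take_poly (p k) (s k))) => [j|].
  rewrite (leq_trans (size_polyD _ _)) // geq_max szq size_polyN.
  exact: size_take_poly.
transitivity (\sum_k horner_alg z (q k) * v k - \sum_k horner_alg z (s k) * v k).
  by rewrite -sumrB; apply: eq_bigr => j _; rewrite rmorphB mulrBl horner_alg_take.
by rewrite qs subrr.
Qed.

(** Modulo (z) only the constant terms of the coordinates matter, and z^m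
    kills the top of a chain only when the chain has length at most m. *)
Lemma annv_chainP m (q : I -> {poly K}) : (forall k, size (q k) <= p k)%N ->
  \sum_k horner_alg z (q k) * v k \in annv z m
    <-> forall k, (m < p k)%N -> (q k)`_0 = 0.
Proof.
have mulC := std_mulC stdA.
have mulz (s : I -> {poly K}) n : z ^+ n * (\sum_k horner_alg z (s k) * v k)
    = \sum_k horner_alg z ('X^n * s k) * v k.
  rewrite mulr_sumr; apply: eq_bigr => k _.
  by rewrite rmorphM rmorphXn /= horner_algX mulrA.
move=> szq; split=> [/(annvP stdA)[u [w [zu def_x]]] k mk|q0].
  have [a [sza def_u]] := chain_span cb (memvf u).
  have [b [szb def_w]] := chain_span cb (memvf w).
  have a0 : (a k)`_0 = 0.
    have /chain_coord/(_ k) : \sum_k horner_alg z (0 : {poly K}) * v k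
        = \sum_k horner_alg z ('X^m * a k) * v k.
      rewrite -mulz -def_u zu big1 // => j _.
      by rewrite rmorph0 mul0r.
    move=> /(_ (fun=> ltac:(by rewrite size_poly0)))/polyP/(_ m).
    by rewrite coef_take_poly mk coef0 coefXnM ltnn subnn.
  have /chain_coord/(_ k) : \sum_k horner_alg z (q k) * v k
      = \sum_k horner_alg z (a k + 'X^1 * b k) * v k.
    rewrite def_x def_u -[z]expr1 def_w mulz -big_split; apply: eq_bigr => j _.
    by rewrite rmorphD mulrDl.
  move=> /(_ szq) ->.
  by rewrite coef_take_poly (leq_trans _ mk) // coefD a0 coefXnM addr0.
apply/(annvP stdA).
exists (\sum_k (q k)`_0 *: v k), (\sum_k horner_alg z (drop_poly 1 (q k)) * v k).
split.
  rewrite mulr_sumr big1 // => k _; rewrite -scalerAr.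
  have [pm|mp] := leqP (p k) m; last by rewrite q0 ?scale0r.
  by rewrite -(subnK pm) exprD -mulrA (chain_end cb) mulr0 scaler0.
rewrite -[z in z * _]expr1 mulz -big_split; apply: eq_bigr => k _ /=.
rewrite -[in LHS](poly_take_drop 1 (q k)) rmorphD mulrDl; congr (_ + _).
  rewrite [take_poly _ _]size1_polyC ?size_take_poly // [LHS]/= horner_algC.
  by rewrite coef_take_poly -scalerAl mul1r.
by rewrite ['X^1 * _]mulrC.
Qed.

Lemma annv_sub_chain m m' : (forall k, (m < p k)%N -> (m' < p k)%N) ->
  (annv z m' <= annv z m)%VS.
Proof.
move=> noblock; apply/subvP => x.
have [q [szq ->]] := chain_span cb (memvf x).
by move=> /(annv_chainP _ szq) q0; apply/annv_chainP => // k /noblock; apply: q0.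
Qed.

Lemma chain_top_annv k m : p k = m.+1 -> (v k \in annv z m.+1) && (v k \notin annv z m).
Proof.
move=> pk; pose q j : {poly K} := if j == k then 1 else 0.
have szq j : (size (q j) <= p j)%N.
  rewrite /q; case: eqP => [->|_]; rewrite ?size_poly0 //.
  by rewrite size_poly1 (chain_gt0 cb).
have -> : v k = \sum_j horner_alg z (q j) * v j.
  rewrite (bigD1 k) //= big1 => [|j /negPf jk].
    by rewrite /q eqxx rmorph1 mul1r addr0.
  by rewrite /q jk rmorph0 mul0r.
apply/andP; split.
  apply/annv_chainP => // j; rewrite /q; case: eqP => [->|_ _]; last by rewrite coef0.
  by rewrite pk ltnn.
apply/negP => /(annv_chainP _ szq)/(_ k); rewrite pk ltnSn /q eqxx coef1.
by move=> /(_ isT)/eqP; rewrite oner_eq0.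
Qed.

End ChainAnnihilators.

Lemma annv_mono m n : (m <= n)%N -> (annv z m <= annv z n)%VS.
Proof.
move/subnK<-; elim: (n - m)%N => // d IH.
exact: subv_trans IH (annvS stdA z _).
Qed.

(** No block size lies strictly between two consecutive entries of the
    decreasing list f. *)
Lemma sorted_gtn_gap (f : seq nat) i (x : nat) : sorted gtn f -> x \in f ->
  (nth 0 f i.+1 < x)%N -> (nth 0 f i <= x)%N.
Proof.
move=> sf /(nthP 0%N)[l lf <-].
have tr : transitive gtn by move=> a b d; rewrite /=; lia.
have homo := sorted_ltn_nth tr 0%N sf.
move=> next; rewrite leqNgt; apply/negP => il.
have ltil : (i < l)%N.
  rewrite ltnNge; apply/negP; rewrite leq_eqVlt => /predU1P[def_l|li].
    by rewrite def_l ltnn in il.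
  have [fi|/(nth_default 0%N) fi0] := ltnP i (size f); last by rewrite fi0 in il.
  by have /(ltn_trans il) := homo _ _ lf fi li; rewrite ltnn.
have [def_l|neq] := eqVneq l i.+1; first by rewrite def_l ltnn in next.
have i1l : (i.+1 < l)%N by lia.
by have /(ltn_trans next) := homo i.+1 l (ltn_trans i1l lf) lf i1l; rewrite ltnn.
Qed.

(** The link with the central simple modules: for m + 1 = f_i, the module U_i
    is the nonzero quotient V_(m+1) / V_m, although its denominator is
    (0 : z^(f_(i+1))) + (z) by definition. *)
Lemma annv_next_size f i : jordan_sizes (amulr z) f -> (i < size f)%N ->
  exists m, [/\ nth 0 f i = m.+1, annv z (nth 0 f i.+1) = annv z m
    & exists w, (w \in annv z m.+1) && (w \notin annv z m)].
Proof.
case=> sf [r [p [jf fp]]] ilt.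
have /(jordan_form_chain_basis (std_mulC stdA))[v cb] := jf.
have /codomP[k pk] : nth 0%N f i \in codom p by rewrite -fp mem_nth.
exists (nth 0 f i).-1; have fi0 : (0 < nth 0 f i)%N by rewrite pk (chain_gt0 cb).
rewrite prednK //; split=> //; last first.
  exists (v k); have := chain_top_annv cb (k := k) (m := (p k).-1).
  by rewrite pk prednK ?(chain_gt0 cb) //; apply.
apply/eqP; rewrite eqEsubv; apply/andP; split.
  apply: annv_mono.
  have [i1f|/(nth_default 0%N)->//] := ltnP i.+1 (size f).
  have tr : transitive gtn by move=> a b d; rewrite /=; lia.
  have : (nth 0 f i.+1 < nth 0 f i)%N := sorted_ltn_nth tr 0%N sf i i.+1 ilt i1f (leqnn _).
  by case: (nth 0 f i) fi0.
apply: (annv_sub_chain cb) => j; rewrite prednK //.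
by apply: sorted_gtn_gap; rewrite // fp codom_f.
Qed.

Section Subquotients.
Variables M N : submodClosed A^o.

Lemma pi_subquotient_eq0 (x : submodule M) :
  (pi_subquotient N x == 0) = (val x \in N).
Proof.
have <- : pi_subquotient N (0 : submodule M) = 0.
  by apply: (addrI (pi_subquotient N (0 : submodule M))); rewrite -pi_subquotientD !addr0.
by rewrite pi_subquotient_eqE subr0.
Qed.

End Subquotients.

(** The degrees in which V_(m+1) / V_m is not zero. *)
Definition central_support m j : Prop :=
  exists x, [/\ x \in gr j, x \in annv z m.+1 & x \notin annv z m].

Section Pieces.
Variables (f : seq nat) (i m : nat).
Hypotheses (fi : nth 0%N f i = m.+1) (fi1 : annv z (nth 0%N f i.+1) = annv z m).

Lemma piece_neq0P j :
  (exists2 v : central_simple_module z f i, central_simple_piece gr j v & v != 0)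
    <-> central_support m j.
Proof.
have memN x : (x \in ann_add z (nth 0%N f i.+1)) = (x \in annv z m) by rewrite -fi1.
have memM x : (x \in ann_add z (nth 0%N f i)) = (x \in annv z m.+1) by rewrite -fi.
split=> [[_ [x [xj ->]]]|[x [xj xM xN]]].
  rewrite pi_subquotient_eq0 memN => xN; exists (val x); split=> //.
  by rewrite -memM; case: (x).
have xM' : x \in ann_add z (nth 0%N f i) by rewrite memM.
pose x' : submodule (ann_add z (nth 0%N f i)) :=
  @Submodule _ A^o (ann_add z (nth 0%N f i)) x xM'.
exists (pi_subquotient (ann_add z (nth 0%N f i.+1)) x'); first by exists x'.
by rewrite pi_subquotient_eq0 memN.
Qed.

Lemma piece_injective j n h (N : central_simple_module z f i -> Prop) :
  bij_between (@central_simple_piece _ _ gr z f i j) N (fun v => h ^+ n *: v) ->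
  forall x, x \in gr j -> x \in annv z m.+1 -> h ^+ n * x \in annv z m -> x \in annv z m.
Proof.
have memN x : (x \in ann_add z (nth 0%N f i.+1)) = (x \in annv z m) by rewrite -fi1.
case=> _ inj _ x xj xM hxN.
have xM' : x \in ann_add z (nth 0%N f i) by move: xM; rewrite -fi.
pose x' : submodule (ann_add z (nth 0%N f i)) :=
  @Submodule _ A^o (ann_add z (nth 0%N f i)) x xM'.
have /eqP : pi_subquotient (ann_add z (nth 0%N f i.+1)) x' = 0.
  apply: inj => [||]; first by exists x'.
    exists 0; split; first exact: mem0v.
    by apply/esym/eqP; rewrite pi_subquotient_eq0 memN mem0v.
  rewrite scaler0 -pi_subquotientZ; apply/eqP.
  by rewrite pi_subquotient_eq0 memN.
by rewrite pi_subquotient_eq0 memN.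
Qed.

Hypothesis (gorA : gorenstein gr) (z1 : z \in gr 1).

Lemma central_support_sym j : central_support m j ->
  (j + m <= c)%N /\ central_support m (c - m - j).
Proof.
case=> x [xj xM xN]; have [jm [y [yc yM yN]]] := central_dual stdA gorA z1 xj xM xN.
by split=> //; exists y.
Qed.

(** The extreme degrees a and b are exchanged by the symmetry of the support,
    so a + b = c - m; this identifies the exponents in the SLP of the module.
    In degrees below a there is nothing to prove. *)
Lemma central_simple_SLP_injective : module_SLP gr (@central_simple_piece _ _ gr z f i) ->
  exists2 g, g \in gr 1 &
    forall n j x, (n + j.*2 + m)%N = c -> x \in gr j -> x \in annv z m.+1 ->
       g ^+ n * x \in annv z m -> x \in annv z m.
Proof.
case=> a [b [/piece_neq0P Pa /piece_neq0P Pb ab [g g1 bij]]].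
exists g => // n j x def_c xj xM gx; apply/negPn/negP => xN.
have bound k : central_support m k -> (a <= k <= b)%N.
  by move=> /piece_neq0P[v vk v0]; apply: ab vk v0.
have [am /bound ca] := central_support_sym Pa.
have [bm /bound cb] := central_support_sym Pb.
have /bound aj : central_support m j by exists x.
case/negP: xN; have half : (j - a <= (b - a)./2)%N by lia.
apply: (piece_injective (bij _ half)) => //; first by rewrite subnKC //; lia.
by have -> : (b - a - (j - a).*2 = n)%N by lia.
Qed.

(** The only Lefschetz map is then the power g^0, for any linear form g. *)
Lemma module_SLP_single_degree j : central_support m j ->
  (forall k, central_support m k -> k = j) ->
  module_SLP gr (@central_simple_piece _ _ gr z f i).
Proof.
move=> /piece_neq0P exj only; exists j, j; split=> // [k v vk v0|].
  by rewrite (only k) ?leqnn //; apply/piece_neq0P; exists v.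
exists z => // k; rewrite subnn leqn0 => /eqP->; rewrite addn0 subn0.
split=> [v|u v _ _|v vj]; rewrite ?expr0 ?scale1r //.
by exists v; rewrite ?scale1r.
Qed.

End Pieces.

Lemma hcomp_annv m j x : z \in gr 1 -> x \in annv z m -> hcomp stdA j x \in annv z m.
Proof.
move=> z1 /(annvP stdA)[u [w [zu ->]]]; rewrite linearD /=.
apply: memvD.
  apply/(annvP stdA); exists (hcomp stdA j u), 0; rewrite mulr0 addr0; split=> //.
  have := congr1 (hcomp stdA (m + j)) zu.
  have zm := grX stdA m z1; rewrite mul1n in zm.
  by rewrite linear0 (hcompM stdA _ _ zm) leq_addr addKn.
rewrite (hcompM stdA _ _ z1); case: ifP => _; last exact: mem0v.
by apply/(annvP stdA); exists 0, (hcomp stdA (j - 1) w); rewrite mulr0 add0r.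
Qed.

(** If 2k + m < c, then z^(m+1) is injective in degree k, so the part of
    degree k of (0 : z^(m+1)) vanishes and V_(m+1) is contained in (z) there.
    The symmetry of the support gives the opposite inequality. *)
Lemma SLP_central_support m j : gorenstein gr -> z \in gr 1 ->
  (forall i, (i <= c./2)%N ->
    bij_between (fun x => x \in gr i) (fun x => x \in gr (c - i)%N)
      (fun x => z ^+ (c - i.*2) * x)) ->
  central_support m j -> (j.*2 + m)%N = c.
Proof.
move=> gorA z1 slp.
suff low k : central_support m k -> (c <= k.*2 + m)%N.
  move=> Pj; have [jm /low lowd] := central_support_sym gorA z1 Pj.
  by have := low j Pj; lia.
case=> x [xk xM xN]; rewrite leqNgt; apply: contra xN => kmc.
move: xM => /(annvP stdA)[u [w [zu def_x]]].
have k2 : (k <= c./2)%N by lia.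
have [_ inj _] := slp k k2.
have u0 : hcomp stdA k u = 0.
  apply: inj; rewrite ?mem0v ?hcomp_mem // mulr0.
  have -> : (c - k.*2 = (c - k.*2 - m.+1) + m.+1)%N by lia.
  have zm := grX stdA m.+1 z1; rewrite mul1n in zm.
  have := hcompM stdA (m.+1 + k) u zm; rewrite zu linear0 leq_addr addKn.
  by rewrite exprD -mulrA => <-; rewrite mulr0.
have := hcomp_homog stdA k xk; rewrite eqxx => <-.
rewrite def_x linearD /= u0 add0r (hcompM stdA _ _ z1).
case: ifP => _; last exact: mem0v.
by apply/(annvP stdA); exists 0, (hcomp stdA (k - 1) w); rewrite mulr0 add0r.
Qed.

Lemma central_support_exists m w : z \in gr 1 ->
  w \in annv z m.+1 -> w \notin annv z m -> exists j, central_support m j.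
Proof.
move=> z1 wM wN.
have [/existsP[j jN]|] := boolP [exists j : 'I_c.+1, hcomp stdA j w \notin annv z m].
  by exists j, (hcomp stdA j w); rewrite hcomp_mem hcomp_annv.
rewrite negb_exists => /forallP all; case/negP: wN.
by rewrite (hcomp_sum stdA w) memv_suml // => j _; apply/negPn/all.
Qed.

Lemma nilpotent_jordan_sizes : z \in gr 1 -> exists f, jordan_sizes (amulr z) f.
Proof.
move=> z1.
have [|x _|I [v [p cb]]] := @chain_basis_exists _ _ (std_mulC stdA) z c.+1 fullv.
- by move=> x _; apply: memvf.
- by rewrite (gr1_expr_eq0 stdA z1) mul0r.
have [r [v' [p' cb']]] := chain_basis_ord cb.
exists (rev (sort leq (undup (codom p')))); split.
  rewrite rev_sorted (eq_sorted (e' := ltn)) //.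
  by rewrite ltn_sorted_uniq_leq sort_uniq undup_uniq sort_sorted //; apply: leq_total.
exists r, p'; split; first by apply/(jordan_form_chain_basis (std_mulC stdA)); exists v'.
by move=> x; rewrite mem_rev mem_sort mem_undup.
Qed.

End CentralSimpleModules.

Theorem theorem1p2 (K : fieldType) (charK : [pchar K] =i pred0)
    (A : falgType K) (gr : nat -> {vspace A}) (c : nat)
    (stdA : standard_graded_artinian gr c) (gorA : gorenstein gr) :
  algebra_SLP gr c <->
  exists2 z : A, z \in gr 1%N & central_simple_modules_SLP gr z.
Proof.
split=> [[z z1 slp]|[z z1 [f [jf slp]]]].
  exists z => //; have [f jf] := nilpotent_jordan_sizes stdA z1.
  exists f; split=> // i /(annv_next_size stdA jf)[m [fi fi1 [w /andP[wM wN]]]].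
  have [j Pj] := central_support_exists stdA z1 wM wN.
  apply: (module_SLP_single_degree fi fi1 z1 Pj) => k Pk.
  have := SLP_central_support stdA gorA z1 slp Pk.
  by have := SLP_central_support stdA gorA z1 slp Pj; lia.
apply: (SLP_of_central_simple_modules charK stdA gorA z1) => m mc.
have [mf|mf] := boolP (m.+1 \in f).
  have /(nthP 0%N)[i ilt fi] := mf.
  have [m' [fi' fi1 _]] := annv_next_size stdA jf ilt.
  have def_m : m' = m by move: fi'; rewrite fi => -[].
  rewrite def_m in fi1.
  exact: (central_simple_SLP_injective stdA fi fi1 gorA z1 (slp i ilt)).
exists z => // n i x _ _ xM _.
have [_ [r [p [jp fp]]]] := jf.
have /(jordan_form_chain_basis (std_mulC stdA))[v cb] := jp.
apply: (subvP (annv_sub_chain stdA cb _)) xM => k mk.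
rewrite ltn_neqAle mk andbT; apply: contra mf => /eqP->.
by rewrite fp codom_f.
Qed.
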